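(* There exists an absolute constant $C>0$ such that for every weight $w\in A_2$ on $\mathbb{R}$, each of the nine operators in the natural weighted resolution of the Haar shift $\mathcal{S}$, $$Q_{\mathcal{S},w}^{(\varepsilon_1,\varepsilon_2),(\varepsilon_3,\varepsilon_4)},\qquad (\varepsilon_1,\varepsilon_2),(\varepsilon_3,\varepsilon_4)\in\{(0,1),(1,0),(0,0)\},$$ is bounded on $L^2=L^2(\mathbb{R})$ with $$\left\Vert Q_{\mathcal{S},w}^{(\varepsilon_1,\varepsilon_2),(\varepsilon_3,\varepsilon_4)}\right\Vert_{L^2\to L^2}\le C\,[w]_{A_2}.$$
   Context: A weight is a positive locally integrable function $w$ on $\mathbb{R}$. Write $\langle f\rangle_I=\frac{1}{|I|}\int_I f\,dx$. The weight $w$ is in $A_2$ if $[w]_{A_2}=\sup_I\langle w\rangle_I\langle w^{-1}\rangle_I<\infty$, where the supremum is over all intervals $I\subset\mathbb{R}$. Let $\mathcal{D}$ be the usual grid of dyadic intervals on $\mathbb{R}$. For $I\in\mathcal{D}$ let $I_-$ and $I_+$ be its left and right dyadic children. Define the Haar function $h_I^0=h_I=|I|^{-1/2}(\mathbf{1}_{I_-}-\mathbf{1}_{I_+})$ and the averaging function $h_I^1=|I|^{-1}\mathbf{1}_I$. For a locally integrable $b$ put $\widehat{b}(I)=\int b\,h_I\,dx$; let $\widehat{b}$ denote the sequence $\{\widehat b(I)\}_{I\in\mathcal{D}}$ and $\langle b\rangle$ the sequence $\{\langle b\rangle_I\}_{I\in\mathcal{D}}$. For a sequence $a=\{a_I\}_{I\in\mathcal{D}}$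 and $(\alpha,\beta)\in\{0,1\}^2$, the dyadic paraproduct of type $(\alpha,\beta)$ with symbol $a$ is $$\mathsf{P}_a^{(\alpha,\beta)}f=\sum_{I\in\mathcal{D}}a_I\,\langle f,h_I^\beta\rangle_{L^2}\,h_I^\alpha .$$ For a function $b$, multiplication by $b$ decomposes as $M_b=\mathsf{P}_{\widehat b}^{(0,1)}+\mathsf{P}_{\widehat b}^{(1,0)}+\mathsf{P}_{\langle b\rangle}^{(0,0)}$. The Haar shift $\mathcal{S}$ is the bounded linear operator on $L^2$ determined by $\mathcal{S}h_I=h_{I_-}-h_{I_+}$ for all $I\in\mathcal{D}$. For a function $b$ write $\mathsf{P}^{(0,1)}[b]=\mathsf{P}_{\widehat b}^{(0,1)}$, $\mathsf{P}^{(1,0)}[b]=\mathsf{P}_{\widehat b}^{(1,0)}$, $\mathsf{P}^{(0,0)}[b]=\mathsf{P}_{\langle b\rangle}^{(0,0)}$. The nine operators are $$Q_{\mathcal{S},w}^{(\varepsilon_1,\varepsilon_2),(\varepsilon_3,\varepsilon_4)}=\mathsf{P}^{(\varepsilon_1,\varepsilon_2)}[w^{1/2}]\;\mathcal{S}\;\mathsf{P}^{(\varepsilon_3,\varepsilon_4)}[w^{-1/2}],$$ so that their sum is $M_{w^{1/2}}\mathcal{S}M_{w^{-1/2}}$ (the natural weighted resolution of $\mathcal{S}$). Since the individual paraproducts need not be bounded on $L^2$, the operator $Q_{\mathcal{S},w}^{(\varepsilon_1,\varepsilon_2),(\varepsilon_3,\varepsilon_4)}$ is understood through its bilinear form $$(\phi,\psi)\mapsto\left\langle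 \mathcal{S}\,\mathsf{P}^{(\varepsilon_3,\varepsilon_4)}[w^{-1/2}]\phi,\ \mathsf{P}^{(\varepsilon_2,\varepsilon_1)}[w^{1/2}]\psi\right\rangle_{L^2},$$ for $\phi,\psi$ finite linear combinations of Haar functions (for such $\phi,\psi$ both entries lie in $L^2$; $\mathsf{P}_a^{(\beta,\alpha)}$ is the formal adjoint of $\mathsf{P}_a^{(\alpha,\beta)}$ for real $a$). Boundedness with norm at most $N$ means that this form is bounded in absolute value by $N\|\phi\|_{L^2}\|\psi\|_{L^2}$, so that it extends to a bounded operator on $L^2$. *)

(* Defs.v *)
From HB Require Import structures.
From mathcomp Require Import all_boot all_order all_algebra finmap.
From mathcomp Require Import all_classical all_reals all_analysis.

Set Implicit Arguments.
Unset Strict Implicit.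
Unset Printing Implicit Defensive.

Import Order.TTheory GRing.Theory Num.Theory.
Import numFieldNormedType.Exports.

Local Open Scope classical_set_scope.
Local Open Scope ring_scope.

(* The pair (k, j) stands for the dyadic interval [j 2^k, (j+1) 2^k[. *)
Notation dyadic := (int * int)%type.

Definition dleft (I : dyadic) : dyadic := (I.1 - 1, 2 * I.2).
Definition dright (I : dyadic) : dyadic := (I.1 - 1, 2 * I.2 + 1).

Section Haar.
Context {R : realType}.
Local Notation mu := (@lebesgue_measure R).
Implicit Types (f g b w phi psi : R -> R) (I : dyadic).

Definition dlen I : R := 2 ^ I.1.

Definition dset I : set R := `[I.2%:~R * dlen I, (I.2 + 1)%:~R * dlen I[%classic.

Definition haar I : R -> R :=
  fun x => (Num.sqrt (dlen I))^-1 * (\1_(dset (dleft I)) x - \1_(dset (dright I)) x).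

Definition haar_avg I : R -> R := fun x => (dlen I)^-1 * \1_(dset I) x.

(* h_I^0 and h_I^1; the superscript is a boolean, with false for 0 and true for 1. *)
Definition hfun (beta : bool) I : R -> R := if beta then haar_avg I else haar I.

Definition L2 f : Prop := f \in Lfun mu 2%:E.

Definition L2norm f : \bar R := ('N[mu]_2%:E[EFin \o f])%E.

Definition L2dot f g : R := \int[mu]_x (f x * g x).

Definition haar_coef b I : R := \int[mu]_x (b x * haar I x).

Definition dyadic_avg b I : R := (dlen I)^-1 * \int[mu]_(x in dset I) b x.

(* Unconditional convergence in L^2 of the series of the u I, with sum g. *)
Definition L2_sum (u : dyadic -> R -> R) g : Prop :=
  L2 g /\
  forall e : R, 0 < e -> exists F0 : {fset dyadic}, forall F : {fset dyadic},
    (F0 `<=` F)%fset ->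
    (L2norm (fun x => g x - \sum_(I <- F) u I x)%R < e%:E)%E.

(* g is the paraproduct P_a^(alpha,beta) f, where t = (alpha, beta). *)
Definition is_paraproduct (a : dyadic -> R) (t : bool * bool) f g : Prop :=
  L2_sum (fun I x => a I * L2dot f (hfun t.2 I) * hfun t.1 I x) g.

Definition natural_types : seq (bool * bool) :=
  [:: (false, true); (true, false); (false, false)].

(* The symbol of P^t[b], for t in natural_types. *)
Definition symbol b (t : bool * bool) : dyadic -> R :=
  if t == (false, false) then dyadic_avg b else haar_coef b.

(* Operators on L^2 act on representatives; linearity and boundedness imply
   that they respect equality almost everywhere. *)
Definition bounded_linear_operator (T : (R -> R) -> (R -> R)) : Prop :=
  [/\ forall f, L2 f -> L2 (T f),
      forall (c : R) f g, L2 f -> L2 g ->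
        T (fun x => c * f x + g x) = (fun x => c * T f x + T g x) %[ae mu] &
      exists M : R, forall f, L2 f -> (L2norm (T f) <= M%:E * L2norm f)%E].

Definition is_haar_shift (S : (R -> R) -> (R -> R)) : Prop :=
  bounded_linear_operator S /\
  forall I, S (haar I) = (fun x => haar (dleft I) x - haar (dright I) x) %[ae mu].

Definition weight w : Prop :=
  (forall x, 0 < w x) /\ locally_integrable [set: R] w.

Definition avgE w (a b : R) : \bar R :=
  ((b - a)^-1%:E * \int[mu]_(x in `[a, b]) (w x)%:E)%E.

Definition A2_char w : \bar R :=
  ereal_sup [set c | exists a b : R, a < b /\
    c = (avgE w a b * avgE (fun x => (w x)^-1)%R a b)%E].

Definition A2_weight w : Prop := weight w /\ (A2_char w < +oo)%E.

Definition haar_polynomial phi : Prop :=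
  exists (F : {fset dyadic}) (c : dyadic -> R),
    phi = fun x => \sum_(I <- F) c I * haar I x.

(* The bilinear form of Q_{S,w}^(t1,t2) is well defined on finite linear
   combinations of Haar functions and has norm at most N: here u is
   P^t2[w^(-1/2)] phi and v is P^t1'[w^(1/2)] psi, with t1' the swap of t1,
   so that v is the formal adjoint of P^t1[w^(1/2)] applied to psi. *)
Definition Q_norm_le (S : (R -> R) -> (R -> R)) w (t1 t2 : bool * bool)
    (N : \bar R) : Prop :=
  forall phi psi, haar_polynomial phi -> haar_polynomial psi ->
  exists u v : R -> R,
    [/\ is_paraproduct (symbol (fun x => w x `^ (- 2^-1)) t2) t2 phi u,
        is_paraproduct (symbol (fun x => w x `^ 2^-1) t1) (t1.2, t1.1) psi v &
        (`|L2dot (S u) v|%:E <= N * L2norm phi * L2norm psi)%E].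

End Haar.

(* Main.v *)
Require Import Defs.
From mathcomp Require Import all_boot all_order all_algebra finmap.
From mathcomp Require Import all_classical all_reals all_analysis.
From mathcomp Require Import measurable_realfun ring lra zify.

(* Write b = w^(1/2), d = w^(-1/2), s = 1/w and Q = [w]_{A_2}. Since d phi =
   P^(0,0)[d] phi + P^(1,0)[d] phi + P^(0,1)[d] phi, the Haar coefficient at
   L of each of the three components is at most
     U_L = |(d phi)^(L)| + <d>_L |phi^(L)| + |d^(L)| |<phi>_L|,
   and similarly for b psi with a bound V_L. As the form of the Haar shift
   pairs the coefficient at L with those at the two children of L, all nine
   estimates follow from a single one: sum_L U~_L V~_L <= C Q |phi| |psi|,
   where U~_L = U_L + U_{L-} + U_{L+}.

   This sum is estimated with stopping intervals: L stops below J when the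
   average over L of one of |d phi|, d, |phi|, |b psi|, b, |psi| is more
   than 12 times the average over J. The stopping intervals form a Carleson
   sequence, and between two stopping times the coefficients of a function f
   have square sum at most C <|f|>_J^2 |J|. Carleson embedding with respect
   to dx bounds the sum of |J| <d>_J^2 over the stopping intervals J in K by
   C s(K), which in turn allows Carleson embedding with respect to s dx for
   d phi; the powers of Q are counted with <b>^2 <= <w>, <d>^2 <= <s>,
   <w><s> <= Q and 1 <= <b><d>. *)

(** The bound is linear in Q because Q is spent only once. Between two stops the averages are frozen
    at J, so a factor <s>_J/<d>_J + <d>_J can be taken out of the coefficients of phi, and its
    analogue out of those of psi. The product of the two factors is at most 4 Q. What remains on
    either side has square sum at most an absolute constant times |phi|^2 or |psi|^2, and
    Cauchy-Schwarz finishes. All six functions share one stopping rule, so that the same J serves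
    both sides. The threshold 12 is twice six: the maximal intervals where one average exceeds 12
    times that over J cover at most 1/12 of J, hence those of all six functions at most half of it.
    The stopping family is never built as a set. A recursion over a finite tree carries the current
    J, and packing, embedding and square sums are inductions on the depth, each with a potential
    that passes from an interval to its children. *)

Set Implicit Arguments.
Unset Strict Implicit.
Unset Printing Implicit Defensive.

Import Order.TTheory GRing.Theory Num.Theory.
Import numFieldNormedType.Exports.

Local Open Scope classical_set_scope.
Local Open Scope ring_scope.

(** * Stopping intervals *)

Section Additive.
Context {R : realType}.
Implicit Types (I J K L : dyadic) (m f F q : dyadic -> R).

Definition dadditive m := forall L, m L = m (dleft L) + m (dright L).

Lemma dlen_gt0 L : 0 < dlen L :> R.
Proof. by rewrite /dlen exprz_gt0. Qed.

Lemma dlen_left L : dlen (dleft L) = dlen L / 2 :> R.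
Proof. by rewrite /dlen /= expfzDr ?pnatr_eq0. Qed.

Lemma dlen_right L : dlen (dright L) = dlen L / 2 :> R.
Proof. by rewrite /dlen /= expfzDr ?pnatr_eq0. Qed.

Lemma dlen_additive : dadditive (@dlen R).
Proof. by move=> L; rewrite dlen_left dlen_right -splitr. Qed.

(* The Haar coefficient at L of a function with integrals m. *)
Definition hc m L : R := (Num.sqrt (dlen L))^-1 * (m (dleft L) - m (dright L)).

Lemma hc_sqr m L : hc m L ^+ 2 = (m (dleft L) - m (dright L)) ^+ 2 / dlen L.
Proof. by rewrite /hc exprMn exprVn sqr_sqrtr ?(ltW (dlen_gt0 L))// mulrC. Qed.

(** Among functions constant on each child of L, h_L and the normalised indicator of L form an
    orthonormal basis; this is Parseval for it. It makes square sums telescope over a tree. *)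
Lemma hc_parallelogram m L : dadditive m ->
  hc m L ^+ 2 + m L ^+ 2 / dlen L =
  m (dleft L) ^+ 2 / dlen (dleft L) + m (dright L) ^+ 2 / dlen (dright L).
Proof.
move=> am; rewrite hc_sqr (am L) dlen_left dlen_right.
have := lt0r_neq0 (dlen_gt0 L); set l := dlen L => l0; field; exact: l0.
Qed.

Definition energy m L : R :=
  hc m L ^+ 2 + hc m (dleft L) ^+ 2 + hc m (dright L) ^+ 2.

(* A potential whose increments from an interval to its children dominate the
   energy. *)
Definition epot m L : R := hc m L ^+ 2 + 2 * (m L ^+ 2 / dlen L).

Lemma epot_ge0 m L : 0 <= epot m L.
Proof.
rewrite addr_ge0 ?sqr_ge0// mulr_ge0// mulr_ge0 ?sqr_ge0// invr_ge0.
exact/ltW/dlen_gt0.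
Qed.

(** The two sides are even equal. The coefficient 2 in [epot] is chosen because the parallelogram
    law must produce the square at L twice, for [energy m L] and for [epot m L]. *)
Lemma epot_step m L : dadditive m ->
  energy m L + epot m L <= epot m (dleft L) + epot m (dright L).
Proof.
move=> am; have := hc_parallelogram L am; rewrite /energy /epot.
have := sqr_ge0 (hc m L); have : 0 <= m L ^+ 2 / dlen L.
  by rewrite divr_ge0 ?sqr_ge0// ltW// dlen_gt0.
lra.
Qed.

Lemma epot_le m nu L : dadditive m -> dadditive nu ->
  (forall K, `|m K| <= nu K) -> epot m L <= 3 * (nu L ^+ 2 / dlen L).
Proof.
move=> am anu mnu; rewrite /epot hc_sqr [X in _ <= X](_ : _ =
  nu L ^+ 2 / dlen L + 2 * (nu L ^+ 2 / dlen L)); last by ring.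
apply: lerD; last first.
  rewrite ler_wpM2l// ler_wpM2r ?invr_ge0 ?(ltW (dlen_gt0 L))//.
  by rewrite -[leLHS]real_normK ?num_real// ler_sqr ?nnegrE// (le_trans _ (mnu
    L)).
rewrite ler_wpM2r ?invr_ge0 ?(ltW (dlen_gt0 L))//.
rewrite -[leLHS]real_normK ?num_real// ler_sqr ?nnegrE//; last first.
  exact: le_trans (mnu L).
by rewrite (le_trans (ler_normB _ _))// [leRHS]anu lerD.
Qed.

(** * Sums over a tree that carry the current stopping interval *)

Section Stopping.
Variables (qs : seq (dyadic -> R)) (stop : R).

Definition stopped J L := has (fun q =>
  stop * (q J / dlen J) < q L / dlen L) qs.

(* Sum over the n first generations of L; the intervals carry the smallest
   stopping interval J that contains them, and a bit that tells whether they
   are stopping intervals themselves. *)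
Fixpoint ssum n (a : bool -> dyadic -> dyadic -> R) J L : R :=
  if n is n'.+1 then
    let s := stopped J L in
    let J' := if s then L else J in
    a s J' L + (ssum n' a J' (dleft L) + ssum n' a J' (dright L))
  else 0.
Implicit Types (a b c : bool -> dyadic -> dyadic -> R).

Definition below k J L := all (fun q => q L / dlen L <= k * (q J / dlen J)) qs.

Hypothesis stop1 : 1 <= stop.
Hypothesis qs_ge0 : forall q, q \in qs -> forall L, 0 <= q L.
Hypothesis qs_additive : forall q, q \in qs -> dadditive q.

Let avg_ge0 q : q \in qs -> forall L, 0 <= q L / dlen L.
Proof. by move=> qqs L; rewrite divr_ge0 ?(qs_ge0 qqs)// ltW// dlen_gt0. Qed.

Let J' J L := if stopped J L then L else J.

Lemma below_state J L : below stop (J' J L) L.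
Proof.
rewrite /J'; case: ifPn => [_|b]; apply/allP => q qqs; last first.
  by move/hasPn: b => /(_ q qqs); rewrite -leNgt.
by rewrite ler_peMl// (avg_ge0 qqs).
Qed.

(** Passing to a child at most doubles an average. Hence the invariant of the inductions is
    [below (2 * stop)]; [below stop] holds only once the state has been updated at L. *)
Lemma below_child J L K : dlen K = dlen L / 2 :> R ->
    (forall q, q \in qs -> q K <= q L) ->
  below stop J L -> below (2 * stop) J K.
Proof.
move=> lK qK /allP b; apply/allP => q qqs; rewrite lK -[leRHS]mulrA.
have l0 := dlen_gt0 L; have -> : q K / (dlen L / 2) = 2 * (q K / dlen L).
  by field; rewrite gt_eqF.
rewrite ler_wpM2l// (le_trans _ (b _ qqs))// ler_wpM2r ?qK//.
by rewrite invr_ge0 ltW.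
Qed.

Lemma below_children J L : below (2 * stop) (J' J L) (dleft L) /\
  below (2 * stop) (J' J L) (dright L).
Proof.
split; apply: below_child (below_state J L); rewrite ?dlen_left ?dlen_right//.
- by move=> q qqs; rewrite (qs_additive qqs L) lerDl (qs_ge0 qqs).
- by move=> q qqs; rewrite (qs_additive qqs L) lerDr (qs_ge0 qqs).
Qed.

Lemma below_refl L : below (2 * stop) L L.
Proof.
by apply/allP => q qqs; rewrite ler_peMl ?(avg_ge0 qqs)//; move: stop1; lra.
Qed.

(** [ssum] updates the state before it evaluates the summand, so the comparison is only needed where
    [below stop] holds. *)
Lemma ssum_le n a b J L :
  (forall s J L, below stop J L -> a s J L <= b s J L) ->
  ssum n a J L <= ssum n b J L.
Proof.
move=> ab; elim: n J L => [//|n IH] J L /=.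
by rewrite !lerD ?IH// ab// below_state.
Qed.

Lemma ssum_ge0 n a J L : (forall s J L, 0 <= a s J L) -> 0 <= ssum n a J L.
Proof. by move=> a0; elim: n J L => [//|n IH] J L /=; rewrite !addr_ge0. Qed.

Lemma ssumZ n a k J L :
  ssum n (fun s J L => k * a s J L) J L = k * ssum n a J L.
Proof. by elim: n J L => [|n IH] J L /=; rewrite ?mulr0// !IH !mulrDr. Qed.

Lemma ssumD n a b J L :
  ssum n (fun s J L => a s J L + b s J L) J L = ssum n a J L + ssum n b J L.
Proof.
elim: n J L => [|n IH] J L /=; first by rewrite addr0.
by rewrite !IH; ring.
Qed.

(** Only linearity and monotonicity of [ssum] are used: 2xy <= t x^2 + y^2/t is summed, and t = B/A
    is optimal. *)
Lemma ssum_CS n (a b : bool -> dyadic -> dyadic -> R) J L (A B C : R) :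
    0 <= A -> 0 <= B ->
    ssum n (fun s J L => a s J L ^+ 2) J L <= C * A ^+ 2 ->
    ssum n (fun s J L => b s J L ^+ 2) J L <= C * B ^+ 2 ->
  ssum n (fun s J L => a s J L * b s J L) J L <= C * A * B.
Proof.
move=> A0 B0 hA hB.
have key (t : R) : 0 < t ->
    ssum n (fun s J L => a s J L * b s J L) J L <=
    (t * (C * A ^+ 2) + t^-1 * (C * B ^+ 2)) / 2.
  move=> t0; rewrite ler_pdivlMr// mulrC -ssumZ.
  apply: le_trans (_ : ssum n (fun s J L => t * a s J L ^+ 2
     + t^-1 * b s J L ^+ 2) J L <= _).
    apply: ssum_le => s K M _; rewrite -subr_ge0.
    have -> : t * a s K M ^+ 2 + t^-1 * b s K M ^+ 2 - 2 * (a s K M * b s K M) =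
      t^-1 * (t * a s K M - b s K M) ^+ 2 by field; rewrite gt_eqF.
    by rewrite mulr_ge0 ?sqr_ge0// invr_ge0 ltW.
  by rewrite ssumD !ssumZ lerD// ler_wpM2l// ?invr_ge0 ltW.
(* Sums of squares are nonnegative, so a negative C forces A = B = 0. *)
have C0 : 0 <= C \/ (A = 0 /\ B = 0).
  have [C0|C0] := leP 0 C; first by left.
  right; have S0 (c : bool -> dyadic -> dyadic -> R) :
      0 <= ssum n (fun s J L => c s J L ^+ 2) J L.
    by apply: ssum_ge0 => *; rewrite sqr_ge0.
  have := le_trans (S0 a) hA; have := le_trans (S0 b) hB.
  by rewrite !nmulr_rge0// !exprn_even_le0//= => /eqP-> /eqP->.
case: C0 => [C0|[A00 B00]]; last first.
  by have := key 1 ltr01; rewrite A00 B00 expr0n/= !mulr0 addr0 mul0r.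
have small (X e : R) : 0 <= X -> 0 < e -> e / (1 + X) * X / 2 <= e.
  move=> X0 e0; have X1 : 0 < 1 + X by lra.
  have -> : e / (1 + X) * X / 2 = e * (X / (2 * (1 + X))).
    by field; rewrite gt_eqF.
  by rewrite ler_piMr ?(ltW e0)// ler_pdivrMr ?mulr_gt0//; lra.
(* For A = 0 there is no optimal t; a large t makes the remaining term at most e. The case B = 0 is
   symmetric, with a small t. *)
have [A00|A_gt0] := leP A 0.
  have AE : A = 0 by apply/eqP; rewrite eq_le A00 A0.
  move: key; rewrite AE => key.
  rewrite mulr0 mul0r; apply/ler_addgt0Pr => e e0; rewrite add0r.
  have := key ((1 + C * B ^+ 2) / e).
  rewrite divr_gt0//; last by rewrite ltr_pwDl// mulr_ge0 ?sqr_ge0.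
  move=> /(_ isT)/le_trans; apply; rewrite expr0n/= !mulr0 add0r invf_div.
  by apply: small; rewrite ?mulr_ge0 ?sqr_ge0.
have [B00|B_gt0] := leP B 0.
  have BE : B = 0 by apply/eqP; rewrite eq_le B00 B0.
  move: key; rewrite BE => key.
  rewrite mulr0; apply/ler_addgt0Pr => e e0; rewrite add0r.
  have := key (e / (1 + C * A ^+ 2)).
  rewrite divr_gt0//; last by rewrite ltr_pwDl// mulr_ge0 ?sqr_ge0.
  move=> /(_ isT)/le_trans; apply; rewrite expr0n/= !mulr0 addr0.
  by apply: small; rewrite ?mulr_ge0 ?sqr_ge0.
have := key (B / A); rewrite divr_gt0// => /(_ isT)/le_trans; apply.
rewrite le_eqVlt; apply/orP; left; apply/eqP; field.
by rewrite !gt_eqF.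
Qed.

(* The right-hand side is additive in L, so the induction has nothing to prove
   except at the stopping intervals. *)
Lemma packing_linear n J L : (size qs)%:R * 2 <= stop ->
    below (2 * stop) J L ->
  ssum n (fun s J L => if s then dlen L else 0) J L <=
  2 * \sum_(q <- qs) (q L / (stop * (q J / dlen J))).
Proof.
move=> Hs; have st0 : 0 < stop := lt_le_trans ltr01 stop1.
have term0 K M q : q \in qs -> 0 <= q M / (stop * (q K / dlen K)).
  by move=> qqs; rewrite divr_ge0 ?(qs_ge0 qqs)// mulr_ge0 ?(avg_ge0 qqs)// ltW.
elim: n J L => [|n IH] J L bJL /=.
  by rewrite mulr_ge0// big_seq; apply: sumr_ge0 => q qqs; exact: term0.
have [] := below_children J L; rewrite /J' => bl br.
have := lerD (IH _ _ bl) (IH _ _ br).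
have sumD K : \sum_(q <- qs) (q L / (stop * (q K / dlen K))) =
    \sum_(q <- qs) (q (dleft L) / (stop * (q K / dlen K))) +
    \sum_(q <- qs) (q (dright L) / (stop * (q K / dlen K))).
  rewrite -big_split/= big_seq [RHS]big_seq; apply: eq_bigr => q qqs.
  by rewrite (qs_additive qqs L) mulrDl.
rewrite -mulrDr -sumD; case: ifPn => st; last by rewrite add0r.
move=> /(lerD (lexx (dlen L)))/le_trans; apply.
(* After a stop the bound restarts with J = L and costs at most [dlen L], since [stop] is at least
   twice the number of functions. Together with L itself this makes [2 * dlen L], which [h2] pays
   for. *)
have h1 : \sum_(q <- qs) (q L / (stop * (q L / dlen L))) <= dlen L / 2.
  apply: le_trans (_ : \sum_(q <- qs) (dlen L / stop) <= _).
    rewrite big_seq [leRHS]big_seq; apply: ler_sum => q qqs.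
    have [->|qL0] := eqVneq (q L) 0.
      by rewrite mul0r divr_ge0// ltW// dlen_gt0.
    rewrite le_eqVlt; apply/orP; left; apply/eqP; field.
    by rewrite qL0 !gt_eqF ?dlen_gt0.
  rewrite big_const_seq count_predT iter_addr_0 -[_ *+ size qs]mulr_natr.
  rewrite -mulrA ler_wpM2l ?(ltW (dlen_gt0 L))//.
  by rewrite mulrC ler_pdivrMr// mulrC ler_pdivlMr.
(* The function that triggered the stop contributes [dlen L] alone. Its average over J is not 0: by
   [below] its average over L would vanish too, and it could not trigger a stop. *)
have h2 : dlen L <= \sum_(q <- qs) (q L / (stop * (q J / dlen J))).
  move/hasP : st => [q qqs qst]; rewrite (big_rem q)//=.
  rewrite ler_wpDr//.
    rewrite big_seq; apply: sumr_ge0 => r rqs; apply: term0.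
    exact: mem_rem rqs.
  have qJ0 : 0 < q J / dlen J.
    rewrite lt_def (avg_ge0 qqs)// andbT; apply/eqP => qJ0.
    move: qst; move/allP: bJL => /(_ _ qqs); rewrite qJ0 !mulr0.
    by rewrite ltNge => ->.
  rewrite ler_pdivlMr; last exact: mulr_gt0.
  rewrite mulrC -ler_pdivlMr ?dlen_gt0//.
  exact: ltW.
lra.
Qed.

Lemma packing n J L : (size qs)%:R * 2 <= stop -> below (2 * stop) J L ->
  ssum n (fun s J L => if s then dlen L else 0) J L <=
  4 * (size qs)%:R * dlen L.
Proof.
move=> Hs b; apply: le_trans (packing_linear n Hs b) _.
have -> : 4 * (size qs)%:R * dlen L = 2 * \sum_(q <- qs) (2 * dlen L) :> R.
  by rewrite big_const_seq count_predT iter_addr_0 -[_ *+ size qs]mulr_natr;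
    ring.
rewrite ler_wpM2l// big_seq [leRHS]big_seq; apply: ler_sum => q qqs.
have [qJ0|qJ0] := eqVneq (q J / dlen J) 0.
  by rewrite qJ0 mulr0 invr0 mulr0 mulr_ge0// ltW// dlen_gt0.
have {}qJ0 : 0 < q J / dlen J by rewrite lt_def qJ0 (avg_ge0 qqs).
have st0 : 0 < stop := lt_le_trans ltr01 stop1.
rewrite ler_pdivrMr; last exact: mulr_gt0.
move/allP: b => /(_ _ qqs); rewrite ler_pdivrMr ?dlen_gt0//; lra.
Qed.

(** Proof by the Bellman function F - f^2/(m + M), where M is the Carleson mass in the tree below L,
    normalised so that M <= m. The constant 4 comes from (m + M)^2 <= 4 m^2. *)
Lemma carleson_embedding n c (m f F : dyadic -> R) (A : R) J L :
    (forall s J L, 0 <= c s J L) -> (forall L, 0 < m L) -> 0 < A ->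
    dadditive m -> dadditive f -> dadditive F ->
    (forall L, f L ^+ 2 <= F L * m L) ->
    (forall n J L, below (2 * stop) J L ->
      ssum n (fun s J L => c s J L * m L ^+ 2) J L <= A * m L) ->
    below (2 * stop) J L ->
  ssum n (fun s J L => c s J L * f L ^+ 2) J L <= 4 * A * F L.
Proof.
move=> c0 m0 A0 am af aF fF packed b.
pose M n J L := ssum n (fun s J L => c s J L * m L ^+ 2) J L / A.
have M0 k K I : 0 <= M k K I.
  rewrite divr_ge0 ?(ltW A0)// ssum_ge0// => *.
  by rewrite mulr_ge0 ?c0// sqr_ge0.
have Mm k K I : below (2 * stop) K I -> M k K I <= m I.
  by move=> /(packed k); rewrite /M ler_pdivrMr// mulrC.
suff : ssum n (fun s J L => c s J L * f L ^+ 2) J L / (4 * A) <=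
    F L - f L ^+ 2 / (m L + M n J L).
  rewrite ler_pdivrMr ?mulr_gt0// => /le_trans; apply.
  rewrite mulrC ler_wpM2l ?mulr_ge0 ?(ltW A0)// gerBl divr_ge0 ?sqr_ge0//.
  by rewrite addr_ge0// ltW.
elim: n J L b => [|n IH] J L b.
  rewrite /M /= !mul0r addr0 subr_ge0 ler_pdivrMr//; exact: fF.
have [bl br] := below_children J L.
have := lerD (IH _ _ bl) (IH _ _ br); have := Mm n.+1 _ _ b.
rewrite {3 4}/M /= -/(J' J L); set JL := J' J L => Mle {}IH.
set sL := stopped J L in Mle *.
pose d := c sL JL L * m L ^+ 2 / A.
pose al := m (dleft L) + M n JL (dleft L).
pose ar := m (dright L) + M n JL (dright L).
have d0 : 0 <= d by rewrite /d divr_ge0 ?(ltW A0)// mulr_ge0 ?sqr_ge0.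
have al0 : 0 < al by rewrite ltr_pwDl.
have ar0 : 0 < ar by rewrite ltr_pwDl.
have a0 : 0 < al + ar by exact: addr_gt0.
have ad0 : 0 < al + ar + d by exact: ltr_wpDr.
have Ma : m L + M n.+1 J L = al + ar + d.
  rewrite /M /= -/(J' J L) -/JL -/sL /al /ar /d /M (am L); field;
    exact: lt0r_neq0.
have {}Mle : al + ar + d <= 2 * m L.
  rewrite -Ma; move: Mle; rewrite /M /= -/(J' J L) -/JL; lra.
have -> : m L + (c sL JL L * m L ^+ 2 +
   (ssum n (fun s J L => c s J L * m L ^+ 2) JL (dleft L) +
    ssum n (fun s J L => c s J L * m L ^+ 2) JL (dright L))) / A = al + ar + d.
  by rewrite -Ma /M /= -/(J' J L) -/JL -/sL.
(* Convexity of (f, a) -> f^2/a, which is homogeneous of degree 1. *)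
have h1 : f L ^+ 2 / (al + ar) <= f (dleft L) ^+ 2 / al +
  f (dright L) ^+ 2 / ar.
  rewrite -subr_ge0 (af L).
  have -> : f (dleft L) ^+ 2 / al + f (dright L) ^+ 2 / ar -
      (f (dleft L) + f (dright L)) ^+ 2 / (al + ar) =
    (ar * f (dleft L) - al * f (dright L)) ^+ 2 / (al * ar * (al + ar)).
    by field; rewrite (gt_eqF ar0) (gt_eqF al0) (gt_eqF a0).
  by rewrite divr_ge0 ?sqr_ge0// ltW// !mulr_gt0.
(* The mass d of L itself enlarges the denominator. The gain pays for the summand at L because both
   denominators are at most [2 * m L]. *)
have h2 : c sL JL L * f L ^+ 2 / (4 * A) <=
    f L ^+ 2 / (al + ar) - f L ^+ 2 / (al + ar + d).
  have -> : f L ^+ 2 / (al + ar) - f L ^+ 2 / (al + ar + d) =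
      (f L ^+ 2 * d) / ((al + ar) * (al + ar + d)).
    by field; rewrite (gt_eqF a0) (gt_eqF ad0).
  have -> : c sL JL L * f L ^+ 2 / (4 * A) = (f L ^+ 2 * d) / (4 * m L ^+ 2).
    by rewrite /d; field; rewrite (gt_eqF A0) (gt_eqF (m0 L)).
  apply: ler_wpM2l; first by apply: mulr_ge0; rewrite ?sqr_ge0.
  rewrite lef_pV2 ?posrE.
  - have -> : 4 * m L ^+ 2 = (2 * m L) * (2 * m L) by ring.
    by rewrite ler_pM ?(ltW a0) ?(ltW ad0)//; move: d0 Mle; lra.
  - by rewrite mulr_gt0 ?exprn_gt0.
  - exact: mulr_gt0.
move: IH h2; rewrite -/al -/ar (aF L); set k := (4 * A)^-1.
by rewrite !mulrDl; move: h1; lra.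
Qed.

(** While J stays fixed, so does the factor g J, and [epot] telescopes down to the next stops or to
    the end of the tree, where [below] compares nu with its average over J. A stop settles the old
    potential and opens a new one with factor g L, paid for by the last sum. The constant is 3 (2
    stop)^2, with the 3 of [epot_le]. *)
Lemma energy_le n (g mu nu : dyadic -> R) J L :
    dadditive mu -> dadditive nu -> (forall L, `|mu L| <= nu L) -> nu \in qs ->
    below (2 * stop) J L ->
  ssum n (fun s J L => g J ^+ 2 * energy mu L) J L + g J ^+ 2 * epot mu L <=
  12 * stop ^+ 2 * (g J ^+ 2 * (dlen L * (nu J / dlen J) ^+ 2) +
  ssum n (fun s J L => if s then g L ^+ 2 * (nu L ^+ 2 / dlen L) else 0) J L).
Proof.
move=> amu anu munu nuqs.
have base K I : below (2 * stop) K I ->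
    epot mu I <= 12 * stop ^+ 2 * (dlen I * (nu K / dlen K) ^+ 2).
  move=> /allP/(_ _ nuqs) bI; apply: le_trans (epot_le _ amu anu munu) _.
  have l0 := dlen_gt0 I.
  have -> : nu I ^+ 2 / dlen I = dlen I * (nu I / dlen I) ^+ 2.
    by field; rewrite gt_eqF.
  have := bI; rewrite -ler_sqr ?nnegrE; first last.
  - rewrite !mulr_ge0 ?(le_trans _ stop1) ?invr_ge0 ?(qs_ge0 nuqs)//.
    by rewrite ltW// dlen_gt0.
  - exact: avg_ge0.
  rewrite exprMn => bI2.
  have := ler_wpM2l (ltW l0) bI2; rewrite exprMn; lra.
elim: n J L => [|n IH] J L bJL.
  rewrite /= add0r addr0 mulrCA; apply: ler_wpM2l; first exact: sqr_ge0.
  exact: base.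
have [bl br] := below_children J L.
have := lerD (IH _ _ bl) (IH _ _ br).
have := epot_step L amu; rewrite /= -/(J' J L); set JL := J' J L.
move=> step.
have := mulr_ge0 (sqr_ge0 (g JL)) (epot_ge0 mu L).
have := ler_wpM2l (sqr_ge0 (g JL)) step.
have len2 : dlen L * (nu JL / dlen JL) ^+ 2 =
    dlen (dleft L) * (nu JL / dlen JL) ^+ 2 +
    dlen (dright L) * (nu JL / dlen JL) ^+ 2.
  by rewrite -mulrDl -dlen_additive.
have := ler_wpM2l (sqr_ge0 (g J)) (base _ _ bJL).
have -> : (if stopped J L then g L ^+ 2 * (nu L ^+ 2 / dlen L) else 0) =
   if stopped J L then g JL ^+ 2 * (dlen L * (nu JL / dlen JL) ^+ 2) else 0.
  rewrite /JL /J'; case: ifP => // _; congr (_ * _); field.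
  by rewrite gt_eqF ?dlen_gt0.
have := congr1 (fun x => 12 * stop ^+ 2 * (g JL ^+ 2 * x)) len2.
rewrite !mulrDr.
set C := 12 * stop ^+ 2.
rewrite /JL /J'; case: ifPn => _; lra.
Qed.

End Stopping.
End Additive.

(** * The bilinear estimate *)

Fixpoint tree n (L : dyadic) : seq dyadic :=
  if n is n'.+1 then L :: tree n' (dleft L) ++ tree n' (dright L) else [::].

Section Bilinear.
Context {R : realType}.
Implicit Types (I J K L : dyadic) (m f F q : dyadic -> R).

Lemma ssum_tree qs (stop : R) n (c : dyadic -> R) J L :
  ssum qs stop n (fun _ _ => c) J L = \sum_(K <- tree n L) c K.
Proof.
elim: n J L => [|n IH] J L /=; first by rewrite big_nil.
by rewrite big_cons big_cat/= !IH.
Qed.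

Definition fam (h : dyadic -> R) K := h K + h (dleft K) + h (dright K).

Lemma fam_ge0 h K : (forall L, 0 <= h L) -> 0 <= fam h K.
Proof. by move=> h0; apply: addr_ge0 => //; exact: addr_ge0. Qed.

Lemma energy_fam m K : fam (fun K => `|hc m K|) K ^+ 2 <= 3 * energy m K.
Proof.
rewrite /fam /energy -(real_normK (num_real (hc m K))).
rewrite -(real_normK (num_real (hc m (dleft K)))).
rewrite -(real_normK (num_real (hc m (dright K)))).
set x := `|_|; set y := `|_|; set z := `|_|.
have := sqr_ge0 (x - y); have := sqr_ge0 (y - z); have := sqr_ge0 (x - z).
rewrite !expr2; lra.
Qed.

(* Integrals over dyadic intervals: D of d, S of d^2, f of d phi, Af of
   |d phi|, p of phi, P1 of |phi| and P2 of phi^2. *)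
Record side (D S f Af p P1 P2 : dyadic -> R) : Prop := Side {
  side_D : dadditive D; side_S : dadditive S; side_f : dadditive f;
  side_Af : dadditive Af; side_p : dadditive p; side_P1 : dadditive P1;
  side_P2 : dadditive P2;
  side_D0 : forall L, 0 < D L; side_S0 : forall L, 0 < S L;
  side_fAf : forall L, `|f L| <= Af L; side_pP1 : forall L, `|p L| <= P1 L;
  side_AfP2 : forall L, Af L ^+ 2 <= P2 L * S L;
  side_P1P2 : forall L, P1 L ^+ 2 <= P2 L * dlen L;
  side_DS : forall L, D L ^+ 2 <= S L * dlen L }.

Definition coefU D f p K : R :=
  `|hc f K| + D K / dlen K * `|hc p K| + `|hc D K| * (`|p K| / dlen K).

(** The three terms of [coefU], normalised to have square sum of order |phi|^2: D/S prepares f for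
    Carleson embedding with respect to S, and in P1/D the D cancels against the size of D at a stop.
    [coefU_le] shows the common factor S/D + D/|J| that this takes out. *)
Definition profile D S f p P1 J K : R :=
  D J / S J * fam (fun K => `|hc f K|) K + fam (fun K => `|hc p K|) K +
  P1 J / D J * fam (fun K => `|hc D K|) K.

Variable qs : seq (dyadic -> R).
Hypothesis size_qs : size qs = 6%N.
Hypothesis qs_ge0 : forall q, q \in qs -> forall L, 0 <= q L.
Hypothesis qs_additive : forall q, q \in qs -> dadditive q.

Let stop : R := 12.
Let stop1 : 1 <= stop. Proof. by rewrite /stop; lra. Qed.

Section OneSide.
Variables D S f Af p P1 P2 : dyadic -> R.
Hypothesis H : side D S f Af p P1 P2.
Hypotheses (Dqs : D \in qs) (Afqs : Af \in qs) (P1qs : P1 \in qs).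

Let D0 := side_D0 H.
Let S0 := side_S0 H.

Lemma P2_ge0 L : 0 <= P2 L.
Proof.
have := le_trans (sqr_ge0 (P1 L)) (side_P1P2 H L).
by rewrite pmulr_lge0// dlen_gt0.
Qed.

Lemma coefU_le J K : below qs stop J K ->
  fam (coefU D f p) K <=
  2 * stop * ((S J / D J + D J / dlen J) * profile D S f p P1 J K).
Proof.
move=> bJK; have l0 := dlen_gt0 J : 0 < dlen J :> R.
have P10 L : 0 <= P1 L by exact: le_trans (side_pP1 H L).
have key M : below qs (2 * stop) J M ->
    coefU D f p M <= 2 * stop * (`|hc f M| + D J / dlen J * `|hc p M| +
      P1 J / dlen J * `|hc D M|).
  move=> /allP b; have /(ler_wpM2r (normr_ge0 (hc p M))) h1 := b _ Dqs.
  have h2 : `|p M| / dlen M <= 2 * stop * (P1 J / dlen J).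
    apply: le_trans (b _ P1qs); rewrite ler_wpM2r ?(side_pP1 H)//.
    by rewrite invr_ge0 ltW// dlen_gt0.
  have := ler_wpM2l (normr_ge0 (hc D M)) h2; have := normr_ge0 (hc f M).
  by rewrite /coefU; move: h1; rewrite /stop; lra.
have bK : below qs (2 * stop) J K.
  apply/allP => q qqs; move/allP: bJK => /(_ _ qqs); rewrite -mulrA.
  move/le_trans; apply; apply: ler_peMl; last by rewrite ler1n.
  rewrite mulr_ge0 ?(le_trans ler01 stop1)// divr_ge0 ?(qs_ge0 qqs)//.
  exact: ltW.
have [bl br] : below qs (2 * stop) J (dleft K)
  /\ below qs (2 * stop) J (dright K).
  split; apply: below_child bJK => //; rewrite ?dlen_left ?dlen_right//.
  - by move=> q qqs; rewrite (qs_additive qqs K) lerDl (qs_ge0 qqs).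
  - by move=> q qqs; rewrite (qs_additive qqs K) lerDr (qs_ge0 qqs).
have := lerD (lerD (key _ bK) (key _ bl)) (key _ br).
rewrite -/(fam _ _) => /le_trans; apply.
rewrite -!mulrDr ler_wpM2l//; first by rewrite /stop; lra.
rewrite /profile.
set F := fam (fun K => `|hc f K|) K; set P := fam (fun K => `|hc p K|) K.
set E := fam (fun K => `|hc D K|) K.
have F0 : 0 <= F by rewrite !addr_ge0.
have P0 : 0 <= P by rewrite !addr_ge0.
have E0 : 0 <= E by rewrite !addr_ge0.
have dJ := D0 J; have sJ := S0 J.
(* Of the six products three are the wanted terms; the others are nonnegative. *)
have -> : (S J / D J + D J / dlen J) * (D J / S J * F + P + P1 J / D J * E) =
  F + D J / dlen J * P + P1 J / dlen J * E + (S J / D J * (P + P1 J / D J * E) +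
    D J / dlen J * (D J / S J * F)).
  by field; rewrite (gt_eqF dJ) (gt_eqF sJ) (gt_eqF l0).
apply: le_trans (_ : F + D J / dlen J * P + P1 J / dlen J * E <= _).
  rewrite /F /P /E /fam; lra.
rewrite lerDl; apply: addr_ge0.
  rewrite mulr_ge0 ?divr_ge0 ?(ltW dJ) ?(ltW sJ)// addr_ge0//.
  by rewrite mulr_ge0// divr_ge0 ?P10// ltW.
rewrite mulr_ge0 ?divr_ge0 ?(ltW dJ) ?(ltW l0)// mulr_ge0//.
by rewrite divr_ge0 ?(ltW dJ) ?(ltW sJ).
Qed.

(** 9 is 3 from squaring three terms times 3 from [energy_fam]; 12^3 is [12 * stop ^+ 2] of
    [energy_le]. In 385 = 1 + 384 and 97 = 1 + 96 the 1 belongs to the root interval and the rest to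
    Carleson embedding; the single 3 is [eP]. *)
Definition side_const : R := 9 * (12 ^+ 3 * 385 + 3 + 12 ^+ 3 * 97).

Lemma side_const_gt0 : 0 < side_const.
Proof. by rewrite /side_const; lra. Qed.

Lemma profile_le n L :
  ssum qs stop n (fun _ J K => profile D S f p P1 J K ^+ 2) L L <=
  side_const * P2 L.
Proof.
have bL := below_refl stop1 qs_ge0 L.
have l0 K : 0 < dlen K :> R := dlen_gt0 K.
have szq : (size qs)%:R * 2 <= stop by rewrite size_qs /stop; lra.
have pack k J K : below qs (2 * stop) J K ->
    ssum qs stop k (fun s J L => if s then dlen L else 0) J K <= 24 * dlen K.
  move=> b; have := packing stop1 qs_ge0 qs_additive k szq b.
  by rewrite size_qs -natrM.
(* Embedding with respect to dx: the weights 1/|L| have Carleson mass |L|, packed with constant 24 =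
   4 * 6, and 96 = 4 * 24. *)
have emb (g G : dyadic -> R) k J K : dadditive g -> dadditive G ->
    (forall L, g L ^+ 2 <= G L * dlen L) -> below qs (2 * stop) J K ->
    ssum qs stop k (fun s J L => if s then g L ^+ 2 / dlen L else 0) J K <=
    96 * G K.
  move=> ag aG gG b.
  have := @carleson_embedding _ _ _ stop1 qs_ge0 qs_additive k
    (fun s _ L => if s then (dlen L)^-1 else 0) (@dlen R) g G 24 J K.
  rewrite -natrM; set X := ssum _ _ _ _ _ _; set Y := ssum _ _ _ _ _ _.
  have -> : X = Y.
    rewrite /X /Y; congr ssum; apply/funext => s; apply/funext => J'.
    by apply/funext => L'; case: s; rewrite ?mul0r// mulrC.
  apply => //.
  - by move=> s _ L'; case: s; rewrite // invr_ge0 ltW.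
  - exact: dlen_additive.
  - move=> k' J' K' b'; apply: le_trans (pack k' _ _ b').
    rewrite le_eqVlt; apply/orP; left; apply/eqP; congr ssum.
    apply/funext => s; apply/funext => J''; apply/funext => L'.
    by case: s; rewrite ?mul0r// expr2 mulKf// gt_eqF.
have embD k J K : below qs (2 * stop) J K ->
    ssum qs stop k (fun s J L => if s then D L ^+ 2 / dlen L else 0) J K <=
    96 * S K := emb _ _ k J K (side_D H) (side_S H) (side_DS H).
have embP := emb _ _ n L L (side_P1 H) (side_P2 H) (side_P1P2 H) bL.
(* Embedding with respect to S: the weights (D/S)^2/|L| times S^2 are D^2/|L|, so [embD] is exactly
   their packing condition, with constant 96; and 384 = 4 * 96. *)
have embF : ssum qs stop n (fun s J L =>
     if s then (D L / S L) ^+ 2 * (Af L ^+ 2 / dlen L) else 0) L L <=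
       384 * P2 L.
  have := @carleson_embedding _ _ _ stop1 qs_ge0 qs_additive n
    (fun s _ L => if s then (D L / S L) ^+ 2 / dlen L else 0) S Af P2 96 L L.
  rewrite -natrM; set X := ssum _ _ _ _ _ _; set Y := ssum _ _ _ _ _ _.
  have -> : X = Y.
    rewrite /X /Y; congr ssum; apply/funext => s; apply/funext => J'.
    by apply/funext => L'; case: s; rewrite ?mul0r// mulrAC mulrA.
  apply => //.
  - by move=> s _ L'; case: s; rewrite // divr_ge0 ?sqr_ge0 ?ltW.
  - exact: side_S H.
  - exact: side_Af H.
  - exact: side_P2 H.
  - exact: side_AfP2 H.
  - move=> k' J' K' b'; apply: le_trans (embD k' _ _ b').
    rewrite le_eqVlt; apply/orP; left; apply/eqP; congr ssum.
    apply/funext => s; apply/funext => J''; apply/funext => L'.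
    case: s; rewrite ?mul0r//; field.
    by rewrite (gt_eqF (l0 L')) (gt_eqF (S0 L')).
have eF := energy_le stop1 qs_ge0 qs_additive n (fun J => D J / S J) (side_f H)
  (side_Af H) (side_fAf H) Afqs bL.
have DD K : `|D K| <= D K by rewrite ger0_norm// ltW.
have eD := energy_le stop1 qs_ge0 qs_additive n (fun J => P1 J / D J) (side_D H)
  (side_D H) DD Dqs bL.
(* The middle term of [profile] has no factor depending on J, so this is a plain Bessel inequality,
   obtained by telescoping [epot]. *)
have eP : ssum qs stop n (fun _ _ K => energy p K) L L <= 3 * P2 L.
  rewrite ssum_tree; apply: le_trans (_ : 3 * P2 L - epot p L <= _); last first.
    by rewrite gerBl epot_ge0.
  elim: n L {bL embP embF eF eD} => [|k IH] L /=.
    rewrite big_nil subr_ge0 (le_trans (epot_le _ (side_p H) (side_P1 H)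
      (side_pP1 H)))//.
    rewrite ler_wpM2l// ler_pdivrMr//; exact: side_P1P2 H L.
  rewrite big_cons big_cat/=; have := lerD (IH (dleft L)) (IH (dright L)).
  have := epot_step L (side_p H); rewrite (side_P2 H L); lra.
have split3 J K : profile D S f p P1 J K ^+ 2 <=
  9 * ((D J / S J) ^+ 2 * energy f K
   + energy p K + (P1 J / D J) ^+ 2 * energy D K).
  rewrite /profile; set x := D J / S J; set y := P1 J / D J.
  have := ler_wpM2l (sqr_ge0 x) (energy_fam f K).
  have := ler_wpM2l (sqr_ge0 y) (energy_fam D K).
  have := energy_fam p K.
  set b := fam (fun K => `|hc f K|) K; set a := fam (fun K => `|hc p K|) K.
  set c := fam _ K; have := sqr_ge0 (x * b - a); have := sqr_ge0 (y * c - a).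
  have := sqr_ge0 (x * b - y * c); rewrite !expr2; lra.
apply: le_trans (ssum_le stop1 qs_ge0 n L L (fun s J K _ => split3 J K)) _.
rewrite ssumZ ssumD ssumD.
have zF : (D L / S L) ^+ 2 * (dlen L * (Af L / dlen L) ^+ 2) <= P2 L.
  have -> : (D L / S L) ^+ 2 * (dlen L * (Af L / dlen L) ^+ 2) =
    (D L ^+ 2 * Af L ^+ 2) / (S L ^+ 2 * dlen L).
    by field; rewrite (gt_eqF (l0 L)) (gt_eqF (S0 L)).
  rewrite ler_pdivrMr ?mulr_gt0 ?exprn_gt0//.
  apply: le_trans (ler_pM (sqr_ge0 _) (sqr_ge0 _) (side_DS H L) (side_AfP2 H
    L)) _.
  by rewrite le_eqVlt; apply/orP; left; apply/eqP; ring.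
have zD : (P1 L / D L) ^+ 2 * (dlen L * (D L / dlen L) ^+ 2) <= P2 L.
  have -> : (P1 L / D L) ^+ 2 * (dlen L * (D L / dlen L) ^+ 2) =
    P1 L ^+ 2 / dlen L.
    by field; rewrite (gt_eqF (l0 L)) (gt_eqF (D0 L)).
  by rewrite ler_pdivrMr//; exact: side_P1P2 H L.
have eqD : ssum qs stop n (fun s J L =>
     if s then (P1 L / D L) ^+ 2 * (D L ^+ 2 / dlen L) else 0) L L =
   ssum qs stop n (fun s J L => if s then P1 L ^+ 2 / dlen L else 0) L L.
  congr ssum; apply/funext => s; apply/funext => J'; apply/funext => L'.
  case: s => //; field; by rewrite (gt_eqF (l0 L')) (gt_eqF (D0 L')).
move: eF eD; rewrite eqD /= /side_const.
have := mulr_ge0 (sqr_ge0 (D L / S L)) (epot_ge0 f L).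
have := mulr_ge0 (sqr_ge0 (P1 L / D L)) (epot_ge0 D L).
rewrite /stop in embF embP eP *; move: embF embP eP zF zD; lra.
Qed.

End OneSide.

(** After [coefU_le] on both sides, [coefs] bounds the product of the extracted factors by 4 Q, and
    Cauchy-Schwarz with [profile_le] does the rest. Here 48^2 = 4 (2 stop)^2. *)
Lemma bilinear_tree (D S f Af p P1 P2 B W g Ag r R1 R2 : dyadic ->
  R) (Q : R) n L :
    side D S f Af p P1 P2 -> side B W g Ag r R1 R2 ->
    perm_eq qs [:: D; Af; P1; B; Ag; R1] ->
    (forall K, dlen K ^+ 2 <= D K * B K) ->
    (forall K, W K * S K <= Q * dlen K ^+ 2) ->
  \sum_(K <- tree n L) (fam (coefU D f p) K * fam (coefU B g r) K) <=
  48 ^+ 2 * side_const * Q * Num.sqrt (P2 L) * Num.sqrt (R2 L).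
Proof.
move=> HD HB /perm_mem eqs DB WS.
have l0 K : 0 < dlen K :> R := dlen_gt0 K.
have [Dqs Afqs P1qs] : [/\ D \in qs, Af \in qs & P1 \in qs].
  by rewrite !eqs !inE !eqxx ?orbT.
have [Bqs Agqs R1qs] : [/\ B \in qs, Ag \in qs & R1 \in qs].
  by rewrite !eqs !inE !eqxx ?orbT.
have coefs J : (S J / D J + D J / dlen J) * (W J / B J + B J / dlen J) <= 4 * Q.
  have d0 := side_D0 HD J; have b0 := side_D0 HB J.
  have s0 := side_S0 HD J; have w0 := side_S0 HB J.
  have h1 := side_DS HD J; have h2 := side_DS HB J.
  have h3 := DB J; have h4 := WS J; have l := l0 J.
  have Q0 : 0 <= Q.
    rewrite -(pmulr_lge0 _ (exprn_gt0 2 l)); apply: le_trans h4.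
    by rewrite mulr_ge0 ?ltW.
  have t1 : S J * W J <= Q * (D J * B J).
    rewrite mulrC; apply: le_trans h4 _; exact: ler_wpM2l.
  have t2 : S J * B J <= Q * (D J * dlen J).
    rewrite -(ler_pM2r b0).
    apply: le_trans (_ : (S J * W J) * dlen J <= _).
      by rewrite -!mulrA ler_wpM2l ?(ltW s0)// -expr2.
    have := ler_wpM2r (ltW l) t1; lra.
  have t3 : D J * W J <= Q * (B J * dlen J).
    rewrite -(ler_pM2r d0).
    apply: le_trans (_ : (S J * W J) * dlen J <= _).
      by have := ler_wpM2r (ltW w0) h1; rewrite expr2; lra.
    have := ler_wpM2r (ltW l) t1; lra.
  (* Directly one only gets (D B)^2 <= Q |J|^4; [h3] then trades one factor |J|^2 for D B. *)
  have t4 : D J * B J <= Q * dlen J ^+ 2.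
    rewrite -(ler_pM2r (mulr_gt0 d0 b0)).
    have := ler_pM (sqr_ge0 _) (sqr_ge0 _) h1 h2 => h12.
    have h4' := ler_wpM2r (sqr_ge0 (dlen J)) h4.
    have h3' : Q * dlen J ^+ 2 * (dlen J ^+ 2) <= Q * dlen J ^+ 2 * (D J * B J).
      by rewrite ler_wpM2l// mulr_ge0// sqr_ge0.
    move: h12 h4' h3'; rewrite !expr2; lra.
  have -> : (S J / D J + D J / dlen J) * (W J / B J + B J / dlen J) =
    S J * W J / (D J * B J) + S J * B J / (D J * dlen J) +
    D J * W J / (B J * dlen J) + D J * B J / dlen J ^+ 2.
    by field; rewrite (gt_eqF l) (gt_eqF d0) (gt_eqF b0).
  have -> : 4 * Q = Q + Q + Q + Q by ring.
  by rewrite !lerD// ler_pdivrMr ?mulr_gt0 ?exprn_gt0.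
rewrite -(ssum_tree qs stop n _ L).
apply: le_trans (_ : ssum qs stop n (fun _ J K => 48 ^+ 2 * Q *
   (profile D S f p P1 J K * profile B W g r R1 J K)) L L <= _).
  apply: ssum_le => // s J K b.
  have c1 := coefU_le HD Dqs P1qs b; have c2 := coefU_le HB Bqs R1qs b.
  have fam0 D' f' p' : (forall K, 0 <= D' K) -> 0 <= fam (coefU D' f' p') K.
    move=> D0; have c0 M : 0 <= coefU D' f' p' M.
      rewrite !addr_ge0 ?mulr_ge0 ?invr_ge0// ?(ltW (l0 _))//.
    exact: fam_ge0.
  have prof0 D' S' f' p' P' : (forall K, 0 <= D' K) -> (forall K, 0 <= S' K) ->
      (forall K, 0 <= P' K) -> 0 <= profile D' S' f' p' P' J K.
    by move=> D0 S0 P0; rewrite /profile /fam !addr_ge0// mulr_ge0 ?divr_ge0//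
      !addr_ge0.
  apply: le_trans (ler_pM (fam0 _ _ _ _) (fam0 _ _ _ _) c1 c2) _.
  - by move=> M; rewrite ltW// (side_D0 HD).
  - by move=> M; rewrite ltW// (side_D0 HB).
  have := coefs J; set X := _ * (W J / B J + _).
  set u := profile _ _ _ _ _ _ _; set v := profile _ _ _ _ _ _ _ => XQ.
  have uv0 : 0 <= u * v.
    rewrite mulr_ge0 ?prof0// => M;
      rewrite ?(ltW (side_D0 HD M)) ?(ltW (side_S0 HD M)) ?(ltW (side_D0 HB M))
      ?(ltW (side_S0 HB M)) ?(le_trans (normr_ge0 _) (side_pP1 HD M))
      ?(le_trans (normr_ge0 _) (side_pP1 HB M))//.
  have := ler_wpM2r uv0 XQ; rewrite /X /stop; lra.
rewrite ssumZ.
have CS := @ssum_CS _ qs stop stop1 qs_ge0 n (fun _ J K =>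
  profile D S f p P1 J K)
   (fun _ J K => profile B W g r R1 J K) L L (Num.sqrt (P2 L)) (Num.sqrt (R2 L))
   side_const (sqrtr_ge0 _) (sqrtr_ge0 _).
rewrite !sqr_sqrtr in CS; [|exact: P2_ge0 HB L|exact: P2_ge0 HD L].
have {}CS := CS (profile_le HD Dqs Afqs n L) (profile_le HB Bqs Agqs n L).
have Q0 : 0 <= Q.
  rewrite -(pmulr_lge0 _ (exprn_gt0 2 (l0 L))); apply: le_trans (WS L).
  by rewrite mulr_ge0 ?ltW// ?(side_S0 HD) ?(side_S0 HB).
have k0 : 0 <= 48 ^+ 2 * Q by rewrite mulr_ge0// exprn_ge0.
apply: le_trans (ler_wpM2l k0 CS) _.
have shuffle (k c x y : R) : k * Q * (c * x * y) = k * c * Q * x * y by ring.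
rewrite shuffle; exact: lexx.
Qed.

End Bilinear.

(** * Dyadic intervals *)

Section DyadicSets.
Context {R : realType}.
Implicit Types (I J K L : dyadic) (x : R).

Lemma dsetE I x :
  dset I x = (I.2%:~R * dlen I <= x < (I.2 + 1)%:~R * dlen I) :> Prop.
Proof. by rewrite /dset /= in_itv. Qed.

Lemma dset_floor I x : dset I x = (Num.floor (x / dlen I) = I.2) :> Prop.
Proof.
rewrite dsetE; have l0 := dlen_gt0 I : 0 < dlen I :> R.
rewrite -ler_pdivlMr// -ltr_pdivrMr// propeqE; split => [h|<-].
  exact: floor_def.
exact: floor_itv.
Qed.

Lemma dset_children I : dset I = dset (dleft I) `|` dset (dright I) :> set R.
Proof.
apply/seteqP; split => x; rewrite /setU /= !dsetE dlen_left dlen_right /=;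
  have l0 := dlen_gt0 I : 0 < dlen I :> R.
  move=> /andP[h1 h2].
  have [h|h] := ltP x ((2 * I.2 + 1)%:~R * (dlen I / 2)).
    by left; apply/andP; split=> //; move: h1; rewrite intrM; lra.
  by right; apply/andP; split=> //; move: h2; rewrite !intrD !intrM; lra.
by case=> /andP[]; rewrite !intrD !intrM => h1 h2; apply/andP; split; lra.
Qed.

Lemma dset_children_disjoint I :
  dset (dleft I) `&` dset (dright I) = set0 :> set R.
Proof.
apply/seteqP; split => // x []; rewrite !dsetE dlen_left dlen_right /=.
by move=> /andP[_ h1] /andP[h2 _]; move: (lt_le_trans h1 h2); rewrite ltxx.
Qed.

Lemma dset_left_sub I : (dset (dleft I) : set R) `<=` dset I.
Proof. by rewrite (dset_children I); exact: subsetUl. Qed.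

Lemma dset_right_sub I : (dset (dright I) : set R) `<=` dset I.
Proof. by rewrite (dset_children I); exact: subsetUr. Qed.

Lemma measurable_dset I : measurable (dset I : set R).
Proof. exact: measurable_itv. Qed.

Lemma lebesgue_measure_dset I : lebesgue_measure (dset I : set R) = (dlen I)%:E.
Proof.
have l0 := dlen_gt0 I : 0 < dlen I :> R.
rewrite /dset lebesgue_measure_itv /= lte_fin ltr_pM2r// ltr_int ltzD1 lexx.
by rewrite -EFinD; congr (_%:E); rewrite intrD; ring.
Qed.

Lemma lebesgue_measure_dset_lty I : (lebesgue_measure (dset I : set R) < +oo)%E.
Proof. by rewrite lebesgue_measure_dset ltry. Qed.

Lemma lebesgue_measure_dset_gt0 I : (0 < lebesgue_measure (dset I : set R))%E.
Proof. by rewrite lebesgue_measure_dset lte_fin dlen_gt0. Qed.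

Lemma dset_nonempty I : dset I (I.2%:~R * dlen I : R).
Proof.
have l0 := dlen_gt0 I : 0 < dlen I :> R.
by rewrite dsetE lexx /= ltr_pM2r// ltr_int ltzD1.
Qed.

Lemma dyadic_parent I : exists P, I = dleft P \/ I = dright P.
Proof.
exists (I.1 + 1, (I.2 %/ 2)%Z); case: I => k j; rewrite /dleft /dright /= addrK.
have := divz_eq j 2; have : (0 <= j %% 2 < 2)%Z.
  by rewrite modz_ge0//= ltz_pmod.
set q := (j %/ 2)%Z; set r := (j %% 2)%Z => hr ->.
have [->|->] : r = 0 \/ r = 1 by lia.
  by left; congr (_, _); lia.
by right; congr (_, _); lia.
Qed.

Lemma dset_same I K x : I.1 = K.1 -> dset I x -> dset K x -> I = K.
Proof.
case: I K => [k i] [l j] /= <-; rewrite !dset_floor /=.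
by move=> h1 h2; congr (_, _); rewrite -h1 -h2.
Qed.

Lemma dset_nest I K : (I.1 <= K.1)%R ->
  (dset I : set R) `<=` dset K \/ dset I `&` dset K = set0 :> set R.
Proof.
move=> IK; have : exists n : nat, K.1 = I.1 + n%:Z.
  by exists `|K.1 - I.1|%N; lia.
move=> [n]; elim: n I {IK} => [|n IH] I e.
  have [->|ne] := eqVneq I K; first by left.
  right; apply/seteqP; split => // x [h1 h2]; apply: (negP ne); apply/eqP.
  by apply: dset_same h1 h2; rewrite e addr0.
have [P IP] := dyadic_parent I.
have sub : (dset I : set R) `<=` dset P.
  by case: IP => ->; [exact: dset_left_sub|exact: dset_right_sub].
have /IH[PK|PK] : K.1 = P.1 + n%:Z.
- by case: IP e => -> /=; lia.
- by left; exact: subset_trans sub PK.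
- right; apply/seteqP; split => // x [h1 h2].
  by rewrite -PK; split => //; exact: sub.
Qed.

Lemma dset_trichotomy I K :
  [\/ dset I `&` dset K = set0 :> set R, I = K |
   [\/ (dset I : set R) `<=` dset (dleft K),
     (dset I : set R) `<=` dset (dright K),
    (dset K : set R) `<=` dset (dleft I) |
      (dset K : set R) `<=` dset (dright I)]].
Proof.
have strict M N : (M.1 < N.1)%R -> [\/ dset M `&` dset N = set0 :> set R,
    (dset M : set R) `<=` dset (dleft N) |
      (dset M : set R) `<=` dset (dright N)].
  move=> MN; have hl : (M.1 <= (dleft N).1)%R by rewrite /= lerBrDr lezD1.
  have hr : (M.1 <= (dright N).1)%R by rewrite /= lerBrDr lezD1.
  have [|h1] := dset_nest hl; first by constructor 2.
  have [|h2] := dset_nest hr; first by constructor 3.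
  by constructor 1; rewrite (dset_children N) setIUr h1 h2 setU0.
have [IK|KI|e] := ltgtP I.1 K.1.
- case: (strict _ _ IK) => h; first by constructor 1.
  + by constructor 3; constructor 1.
  + by constructor 3; constructor 2.
- case: (strict _ _ KI) => h; first by constructor 1; rewrite setIC.
  + by constructor 3; constructor 3.
  + by constructor 3; constructor 4.
- have [->|ne] := eqVneq I K; first by constructor 2.
  constructor 1; apply/seteqP; split => // x [h1 h2]; apply: (negP ne).
  by apply/eqP; exact: dset_same h1 h2.
Qed.

Lemma tree_dset n J K : K \in tree n J -> (dset K : set R) `<=` dset J.
Proof.
elim: n J => [//|n IH] J /=; rewrite inE mem_cat => /or3P[/eqP->//|/IH h|/IH h].
- exact: subset_trans (@dset_left_sub J).
- exact: subset_trans (@dset_right_sub J).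
Qed.

Lemma tree_scale n J K : K \in tree n J -> (K.1 <= J.1)%R.
Proof.
elim: n J => [//|n IH] J /=; rewrite inE mem_cat.
by move=> /or3P[/eqP->//|/IH h|/IH h]; apply: le_trans h _; rewrite /= ?gerBl.
Qed.

Lemma uniq_tree n J : uniq (tree n J).
Proof.
elim: n J => [//|n IH] J /=; rewrite cat_uniq !IH andbT/=.
rewrite mem_cat negb_or -andbA; apply/and3P; split.
- by apply/negP => /tree_scale /=; lia.
- by apply/negP => /tree_scale /=; lia.
- apply/hasPn => K Kr; apply/negP => Kl.
  have : (dset (dleft J) `&` dset (dright J)) (K.2%:~R * dlen K : R).
    by split; [apply: tree_dset Kl _ _|apply: tree_dset Kr _ _];
      exact: dset_nonempty.
  by rewrite dset_children_disjoint.
Qed.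

Lemma mem_tree p n (m i : int) (j : nat) : (p < n)%N -> (j < 2 ^ p)%N ->
  (m - p%:Z, (2 ^ p)%N%:Z * i + j%:Z) \in tree n (m, i).
Proof.
elim: p n m i j => [|p IH] [//|n] m i j pn jp.
  rewrite inE; apply/orP; left; apply/eqP; congr (_, _); rewrite ?expn0;
    move: jp; rewrite expn0; lia.
rewrite /= inE mem_cat; apply/orP; right; apply/orP; rewrite /dleft /dright /=.
have [h|h] := ltnP j (2 ^ p).
  left; have -> : (m - p.+1%:Z, (2 ^ p.+1)%N%:Z * i + j%:Z) =
      (m - 1 - p%:Z, (2 ^ p)%N%:Z * (2 * i) + j%:Z).
    by congr (_, _); rewrite ?expnS; lia.
  exact: IH.
right; have h' : (j - 2 ^ p < 2 ^ p)%N by move: jp; rewrite expnS; lia.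
have -> : (m - p.+1%:Z, (2 ^ p.+1)%N%:Z * i + j%:Z) =
    (m - 1 - p%:Z, (2 ^ p)%N%:Z * (2 * i + 1) + (j - 2 ^ p)%N%:Z).
  by congr (_, _); rewrite ?expnS; lia.
exact: IH.
Qed.

(** No dyadic interval crosses 0, hence the two roots [0, 2^m[ and [-2^m, 0[. The free p allows a
    finite family to be placed under common roots. *)
Lemma dyadic_in_tree (I : dyadic) : exists M : int, exists N : nat,
  forall (p n : nat), (N + p <= n)%N ->
    I \in tree n (M + p%:Z, 0) ++ tree n (M + p%:Z, -1).
Proof.
case: I => k j; pose a := `|j|%N; have ja : (a < 2 ^ a)%N by exact: ltn_expl.
exists (k + a%:Z), a.+1 => p n Nn; rewrite mem_cat; apply/orP.
have ap : (2 ^ a <= 2 ^ (a + p))%N by rewrite leq_exp2l// leq_addr.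
have [j0|j0] := leP 0 j; [left|right].
  have := @mem_tree (a + p) n (k + a%:Z + p%:Z) 0 a.
  have -> : (k + a%:Z + p%:Z - (a + p)%N%:Z, (2 ^ (a + p))%N%:Z * 0 + a%:Z) =
    (k, j).
    by congr (_, _); rewrite /a; lia.
  by apply; [lia|exact: leq_trans ap].
have := @mem_tree (a + p) n (k + a%:Z + p%:Z) (-1) (2 ^ (a + p) - a).
have -> : (k + a%:Z + p%:Z - (a + p)%N%:Z,
   (2 ^ (a + p))%N%:Z * -1 + (2 ^ (a + p) - a)%N%:Z) = (k, j).
  by congr (_, _); [lia|rewrite -subzn ?(ltnW (leq_trans ja ap))// /a; lia].
have a0 : (0 < a)%N by rewrite /a; lia.
apply; first lia.
by rewrite ltn_subrL a0 expn_gt0.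
Qed.

End DyadicSets.

(** * Integrals over dyadic intervals *)

Section Integrals.
Context {R : realType}.
Local Notation mu := (@lebesgue_measure R).
Implicit Types (I J K L : dyadic) (f g u v : R -> R) (D : set R).

Lemma integrableRD D f g : measurable D ->
    mu.-integrable D (EFin \o f) -> mu.-integrable D (EFin \o g) ->
  mu.-integrable D (EFin \o (fun x => f x + g x)).
Proof.
by move=> mD fi gi; apply: eq_integrable (integrableD (mu := mu) mD fi gi).
Qed.

Lemma integrableRZ D c f : measurable D -> mu.-integrable D (EFin \o f) ->
  mu.-integrable D (EFin \o (fun x => c * f x)).
Proof.
by move=> mD fi; apply: eq_integrable (integrableZl (mu := mu) mD c fi).
Qed.

Lemma integrableRB D f g : measurable D ->
    mu.-integrable D (EFin \o f) -> mu.-integrable D (EFin \o g) ->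
  mu.-integrable D (EFin \o (fun x => f x - g x)).
Proof.
by move=> mD fi gi; apply: eq_integrable (integrableB (mu := mu) mD fi gi).
Qed.

Definition sqr_integrable D f :=
  measurable_fun D f /\ mu.-integrable D (EFin \o (fun x => f x ^+ 2)).

Lemma sqr_integrableM D f g : measurable D ->
    sqr_integrable D f -> sqr_integrable D g ->
  mu.-integrable D (EFin \o (fun x => f x * g x)).
Proof.
move=> mD [mf if2] [mg ig2].
apply: (@le_integrable _ _ _ mu D mD _
    (EFin \o (fun x => f x ^+ 2 + g x ^+ 2))) => //.
- by apply/measurable_EFinP; exact: measurable_funM.
- move=> x _ /=; rewrite lee_fin normrM [leRHS]ger0_norm ?addr_ge0 ?sqr_ge0//.
  rewrite -(real_normK (num_real (f x))) -(real_normK (num_real (g x))).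
  set a := `|f x|; set b := `|g x|.
  have := sqr_ge0 (a - b); have := sqr_ge0 (a + b).
  by rewrite !expr2; lra.
- exact: integrableRD.
Qed.

Lemma sqr_integrableD D f g : measurable D ->
    sqr_integrable D f -> sqr_integrable D g ->
  sqr_integrable D (fun x => f x + g x).
Proof.
move=> mD hf hg; have fg := sqr_integrableM mD hf hg.
case: hf hg => mf if2 [mg ig2]; split; first exact: measurable_funD.
have := integrableRD mD (integrableRD mD if2 ig2) (integrableRZ 2 mD fg).
by congr integrable; apply/funext => x /=; congr (_%:E); ring.
Qed.

Lemma sqr_integrableZ D c f : measurable D -> sqr_integrable D f ->
  sqr_integrable D (fun x => c * f x).
Proof.
move=> mD [mf if2]; split; first exact: measurable_funM.
have := integrableRZ (c ^+ 2) mD if2.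
by congr integrable; apply/funext => x /=; rewrite exprMn.
Qed.

Lemma sqr_integrable_sum D (A : eqType) (s : seq A) (h : A -> R -> R) :
    measurable D -> (forall i, sqr_integrable D (h i)) ->
  sqr_integrable D (fun x => \sum_(i <- s) h i x).
Proof.
move=> mD hh; elim: s => [|i s IH].
  rewrite (_ : (fun _ => _) = fun x => 0 * 0); last first.
    by apply/funext => x; rewrite big_nil mulr0.
  apply: sqr_integrableZ => //; split => //.
  apply: eq_integrable (integrable0 mu D) => //= x _.
  by rewrite expr0n.
rewrite (_ : (fun _ => _) = fun x => h i x + \sum_(j <- s) h j x).
  exact: sqr_integrableD.
by apply/funext => x; rewrite big_cons.
Qed.

Lemma le_integrable_bounded D f g (M : R) : measurable D ->
    measurable_fun D g -> (forall x, D x -> `|g x| <= M * `|f x|) ->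
  mu.-integrable D (EFin \o f) -> mu.-integrable D (EFin \o g).
Proof.
move=> mD mg gM fi.
apply: (@le_integrable _ _ _ mu D mD _ (EFin \o (fun x => M * f x))).
- exact/measurable_EFinP.
- move=> x Dx /=; rewrite lee_fin (le_trans (gM _ Dx))// normrM ler_wpM2r//.
  exact: ler_norm.
- exact: integrableRZ.
Qed.

Lemma sqr_integrable_bounded D f g (M : R) : measurable D ->
    measurable_fun D g -> (forall x, D x -> `|g x| <= M * `|f x|) ->
  sqr_integrable D f -> sqr_integrable D g.
Proof.
move=> mD mg gM [mf if2]; split => //.
apply: (@le_integrable_bounded _ _ _ (M ^+ 2) mD _ _ if2).
  exact: measurable_funX.
move=> x Dx; rewrite !normrX -exprMn lerXn2r ?nnegrE ?gM//.
exact: le_trans (gM _ Dx).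
Qed.

Lemma Rintegral_CS D f g : measurable D ->
    sqr_integrable D f -> sqr_integrable D g ->
  (\int[mu]_(x in D) (f x * g x)) ^+ 2 <=
  (\int[mu]_(x in D) (f x ^+ 2)) * (\int[mu]_(x in D) (g x ^+ 2)).
Proof.
move=> mD hf hg; have fg := sqr_integrableM mD hf hg.
case: (hf) (hg) => mf if2 [mg ig2].
set A := \int[mu]_(x in D) (f x ^+ 2); set C := \int[mu]_(x in D) (g x ^+ 2).
set B := \int[mu]_(x in D) (f x * g x).
have quad (s t : R) : 0 <= s ^+ 2 * A - 2 * (s * t) * B + t ^+ 2 * C.
  have -> : s ^+ 2 * A - 2 * (s * t) * B + t ^+ 2 * C =
      \int[mu]_(x in D) ((s ^+ 2 * f x ^+ 2 - 2 * (s * t) * (f x * g x)) +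
        t ^+ 2 * g x ^+ 2).
    rewrite RintegralD//.
    - rewrite RintegralB// ?RintegralZl//.
      + exact: integrableRZ.
      + exact: integrableRZ.
    - apply: integrableRB => //; exact: integrableRZ.
    - exact: integrableRZ.
  apply: Rintegral_ge0 => x _.
  have -> : s ^+ 2 * f x ^+ 2 - 2 * (s * t) * (f x * g x) + t ^+ 2 * g x ^+ 2 =
    (s * f x - t * g x) ^+ 2 by ring.
  exact: sqr_ge0.
have A0 : 0 <= A by apply: Rintegral_ge0 => x _; exact: sqr_ge0.
have C0 : 0 <= C by apply: Rintegral_ge0 => x _; exact: sqr_ge0.
have [C00|C_gt0] := leP C 0; last first.
  have := quad C B; have -> : C ^+ 2 * A - 2 * (C * B) * B + B ^+ 2 * C =
    C * (A * C - B ^+ 2) by ring.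
  by rewrite pmulr_rge0// subr_ge0.
have CE : C = 0 by apply/eqP; rewrite eq_le C00.
have [B0|B0] := eqVneq B 0; first by rewrite B0 expr0n mulr_ge0.
(* With C = 0 the form is affine in t, and this t gives it the value A - (A + 1), which is
   negative. *)
have := quad 1 ((A + 1) / (2 * B)); rewrite CE mulr0 addr0 expr1n !mul1r.
have -> : 2 * ((A + 1) / (2 * B)) * B = A + 1 by field.
lra.
Qed.

Definition ig g L : R := \int[mu]_(x in dset L) g x.

Definition loc1 g := measurable_fun setT g /\
  forall I, mu.-integrable (dset I) (EFin \o g).

Definition loc2 f := measurable_fun setT f /\
  forall I, mu.-integrable (dset I) (EFin \o (fun x => f x ^+ 2)).

Lemma loc2P f : loc2 f <->
  measurable_fun setT f /\ forall I, sqr_integrable (dset I) f.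
Proof.
split=> [[mf h]|[mf h]]; split=> // I; last by case: (h I).
by split => //; exact: measurable_funS mf.
Qed.

Lemma loc2_sqr f : loc2 f -> loc1 (fun x => f x ^+ 2).
Proof. by move=> [mf h]; split => //; exact: measurable_funX. Qed.

Lemma loc2M f g : loc2 f -> loc2 g -> loc1 (fun x => f x * g x).
Proof.
move=> /loc2P[mf hf] /loc2P[mg hg]; split; first exact: measurable_funM.
by move=> I; apply: sqr_integrableM => //; exact: measurable_dset.
Qed.

Lemma loc2_cst c : loc2 (fun=> c).
Proof.
split => // I; apply: measurable_bounded_integrable.
- exact: measurable_dset.
- exact: lebesgue_measure_dset_lty.
- exact: measurable_cst.
- by exists `|c ^+ 2|; split=> // M /ltW cM x _; exact: cM.
Qed.

Lemma loc2_loc1 f : loc2 f -> loc1 f.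
Proof.
move=> /loc2M/(_ (loc2_cst 1)); congr loc1.
by apply/funext => x; rewrite mulr1.
Qed.

Lemma loc2D f g : loc2 f -> loc2 g -> loc2 (fun x => f x + g x).
Proof.
move=> /loc2P[mf hf] /loc2P[mg hg]; apply/loc2P; split.
  exact: measurable_funD.
by move=> I; apply: sqr_integrableD => //; exact: measurable_dset.
Qed.

Lemma loc2Z c f : loc2 f -> loc2 (fun x => c * f x).
Proof.
move=> /loc2P[mf hf]; apply/loc2P; split; first exact: measurable_funM.
by move=> I; apply: sqr_integrableZ => //; exact: measurable_dset.
Qed.

Lemma loc2_sum (A : eqType) (s : seq A) (h : A -> R -> R) :
  (forall i, loc2 (h i)) -> loc2 (fun x => \sum_(i <- s) h i x).
Proof.
move=> hh; apply/loc2P; split; last first.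
  move=> I; apply: sqr_integrable_sum; first exact: measurable_dset.
  by move=> i; case/loc2P : (hh i).
elim: s => [|i s IH].
  by under eq_fun do rewrite big_nil; exact: measurable_cst.
under eq_fun do rewrite big_cons.
by apply: measurable_funD => //; case: (hh i).
Qed.

Lemma loc2_bounded (M : R) f g : measurable_fun setT g ->
  (forall x, `|g x| <= M * `|f x|) -> loc2 f -> loc2 g.
Proof.
move=> mg gM /loc2P[mf hf]; apply/loc2P; split => // I.
apply: sqr_integrable_bounded (hf I) => //; first exact: measurable_dset.
exact: measurable_funS mg.
Qed.

Lemma loc1D f g : loc1 f -> loc1 g -> loc1 (fun x => f x + g x).
Proof.
move=> [mf hf] [mg hg]; split; first exact: measurable_funD.
by move=> I; apply: integrableRD => //; exact: measurable_dset.
Qed.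

Lemma loc1Z c f : loc1 f -> loc1 (fun x => c * f x).
Proof.
move=> [mf hf]; split; first exact: measurable_funM.
by move=> I; apply: integrableRZ => //; exact: measurable_dset.
Qed.

Lemma loc1_norm f : loc1 f -> loc1 (fun x => `|f x|).
Proof.
move=> [mf hf]; split; first exact: measurableT_comp.
by move=> I; exact: integrable_norm.
Qed.

Lemma ig_dadditive g : loc1 g -> dadditive (ig g).
Proof.
move=> [mg hg] L; rewrite /ig [in LHS]dset_children Rintegral_setU//.
- exact: measurable_dset.
- exact: measurable_dset.
- by rewrite -dset_children.
- by apply/disj_set2P; exact: dset_children_disjoint.
Qed.

Lemma igD f g L : loc1 f -> loc1 g ->
  ig (fun x => f x + g x) L = ig f L + ig g L.
Proof. by move=> [_ hf] [_ hg]; rewrite /ig RintegralD//;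
  exact: measurable_dset. Qed.

Lemma igZ c f L : loc1 f -> ig (fun x => c * f x) L = c * ig f L.
Proof. by move=> [_ hf]; rewrite /ig RintegralZl//; exact: measurable_dset. Qed.

Lemma ig_cst c L : ig (fun=> c) L = c * dlen L.
Proof.
rewrite /ig Rintegral_cst; last exact: measurable_dset.
by congr (_ * _); have /(congr1 fine) := @lebesgue_measure_dset R L.
Qed.

Lemma ig_le f g L : loc1 f -> loc1 g -> (forall x, dset L x -> f x <= g x) ->
  ig f L <= ig g L.
Proof.
by move=> [_ hf] [_ hg] fg; apply: le_Rintegral => //; exact: measurable_dset.
Qed.

Lemma ig_ge0 f L : (forall x, 0 <= f x) -> 0 <= ig f L.
Proof. by move=> f0; apply: Rintegral_ge0. Qed.

Lemma eq_ig f g L : (forall x, dset L x -> f x = g x) -> ig f L = ig g L.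
Proof. by move=> fg; apply: eq_Rintegral => x; rewrite inE; exact: fg. Qed.

Lemma ig_norm f L : loc1 f -> `|ig f L| <= ig (fun x => `|f x|) L.
Proof. by move=> [_ hf]; apply: le_normr_Rintegral => //;
  exact: measurable_dset. Qed.

Lemma integral_gt0 D f : measurable D -> (0 < mu D)%E ->
    measurable_fun D f -> (forall x, D x -> 0 < f x) ->
  (0 < \int[mu]_(x in D) (f x)%:E)%E.
Proof.
move=> mD D0 mf f0; rewrite lt_def integral_ge0 ?andbT; last first.
  by move=> x Dx; rewrite lee_fin ltW// f0.
apply/eqP => f00.
have : (\int[mu]_(x in D) `|(f x)%:E| = 0)%E.
  rewrite -[RHS]f00; apply: eq_integral => x; rewrite inE => Dx.
  by rewrite gee0_abs// lee_fin ltW// f0.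
move/ae_eq_integral_abs => /(_ mD); case; first exact/measurable_EFinP.
move=> N [mN N0 sub]; move: D0; rewrite ltNge => /negP; apply.
rewrite -N0; apply: le_measure; rewrite ?inE// => x Dx; apply: sub => /=.
by move=> /(_ Dx) [] e; move: (f0 _ Dx); rewrite e ltxx.
Qed.

Lemma ig_gt0 f L : loc1 f -> (forall x, 0 < f x) -> 0 < ig f L.
Proof.
move=> [mf hf] f0; rewrite -lte_fin fineK; last first.
  by apply: integrable_fin_num => //; exact: measurable_dset.
apply: integral_gt0 => //; first exact: measurable_dset.
- exact: lebesgue_measure_dset_gt0.
- exact: measurable_funS mf.
Qed.

Lemma ig_CS f g L : loc2 f -> loc2 g ->
  ig (fun x => f x * g x) L ^+ 2 <=
  ig (fun x => f x ^+ 2) L * ig (fun x => g x ^+ 2) L.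
Proof.
move=> /loc2P[_ hf] /loc2P[_ hg]; apply: Rintegral_CS => //.
exact: measurable_dset.
Qed.

(** Since g = 1/f, pointwise f/t + t g >= 2; integrate this over L with t the average of f. *)
Lemma dlen_sqr_le f g L : loc1 f -> loc1 g -> (forall x, 0 < f x) ->
  (forall x, f x * g x = 1) -> dlen L ^+ 2 <= ig f L * ig g L.
Proof.
move=> hf hg f0 fg; have g0 x : 0 < g x by rewrite -(pmulr_rgt0 _ (f0 x)) fg.
have F0 := ig_gt0 L hf f0; have l0 := dlen_gt0 L : 0 < dlen L :> R.
pose t := ig f L / dlen L; have t0 : 0 < t by rewrite divr_gt0.
have : ig (fun=> 2) L <= ig (fun x => t^-1 * f x + t * g x) L.
  apply: ig_le => [||x _].
  - exact/loc2_loc1/loc2_cst.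
  - by apply: loc1D; exact: loc1Z.
  - rewrite -subr_ge0.
    have -> : t^-1 * f x + t * g x - 2 = (f x - t) ^+ 2 / (t * f x).
      have -> : g x = (f x)^-1 by rewrite -[RHS]mul1r -(fg x) mulrAC mulfV
        ?mul1r// gt_eqF.
      by field; rewrite (gt_eqF t0) (gt_eqF (f0 x)).
    by rewrite divr_ge0 ?sqr_ge0// ltW// mulr_gt0.
rewrite ig_cst igD ?igZ//; [|exact: loc1Z..].
have -> : t^-1 * ig f L + t * ig g L = dlen L + ig f L * ig g L / dlen L.
  by rewrite /t; field; rewrite (gt_eqF l0) (gt_eqF F0).
by move=> h; rewrite expr2 -ler_pdivlMr//; lra.
Qed.

End Integrals.

(** * Haar coefficients of products *)

Section HaarCalculus.
Context {R : realType}.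
Local Notation mu := (@lebesgue_measure R).
Implicit Types (I J K L : dyadic) (f g u v : R -> R) (D : set R) (x : R).

Let s I : R := (Num.sqrt (dlen I))^-1.

Let s_ge0 I : 0 <= s I. Proof. by rewrite invr_ge0 sqrtr_ge0. Qed.

Lemma haar_left I x : dset (dleft I) x -> haar I x = s I.
Proof.
move=> h; rewrite /haar !indicE mem_set// memNset ?subr0 ?mulr1// => h'.
suff : set0 x by []; by rewrite -(dset_children_disjoint I).
Qed.

Lemma haar_right I x : dset (dright I) x -> haar I x = - s I.
Proof.
move=> h; rewrite /haar !indicE memNset ?mem_set ?sub0r ?mulrN1// => h'.
suff : set0 x by []; by rewrite -(dset_children_disjoint I).
Qed.

Lemma haar_out I x : ~ dset I x -> haar I x = 0.
Proof.
move=> h; rewrite /haar !indicE !memNset ?subr0 ?mulr0// => h'; apply: h.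
- exact: dset_right_sub.
- exact: dset_left_sub.
Qed.

Lemma haar_avg_in I x : dset I x -> haar_avg I x = (dlen I)^-1.
Proof. by move=> h; rewrite /haar_avg indicE mem_set// mulr1. Qed.

Lemma haar_avg_out I x : ~ dset I x -> haar_avg I x = 0.
Proof. by move=> h; rewrite /haar_avg indicE memNset// mulr0. Qed.

Lemma haar_bound I x : `|haar I x| <= s I.
Proof.
have [h|h] := pselect (dset I x); last by rewrite haar_out ?normr0.
move: h; rewrite dset_children => -[h|h].
  by rewrite haar_left// ger0_norm.
by rewrite haar_right// normrN ger0_norm.
Qed.

Lemma measurable_haar I : measurable_fun setT (haar I : R -> R).
Proof.
apply: measurable_funM => //; apply: measurable_funB.
- by apply: measurable_indic; exact: measurable_dset.
- by apply: measurable_indic; exact: measurable_dset.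
Qed.

Lemma measurable_haar_avg I : measurable_fun setT (haar_avg I : R -> R).
Proof.
by apply: measurable_funM => //; apply: measurable_indic;
  exact: measurable_dset.
Qed.

Lemma loc2_haar I : loc2 (haar I : R -> R).
Proof.
apply: (@loc2_bounded _ (s I) (fun=> 1)); first exact: measurable_haar.
- by move=> x; rewrite normr1 mulr1 haar_bound.
- exact: loc2_cst.
Qed.

Lemma loc2_haar_avg I : loc2 (haar_avg I : R -> R).
Proof.
apply: (@loc2_bounded _ ((dlen I)^-1) (fun=> 1));
  first exact: measurable_haar_avg.
- move=> x; rewrite normr1 mulr1.
  have l0 : 0 <= (dlen I : R)^-1 by rewrite invr_ge0 ltW// dlen_gt0.
  have [h|h] := pselect (dset I x); first by rewrite haar_avg_in// ger0_norm.
  by rewrite haar_avg_out// normr0.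
- exact: loc2_cst.
Qed.

Lemma Rintegral_mul_indic D g : \int[mu]_x (g x * \1_D x) =
  \int[mu]_(x in D) g x.
Proof.
rewrite [RHS]Rintegral_mkcond; apply: eq_Rintegral => x _.
by rewrite patchE indicE; case: (x \in D); rewrite ?mulr1 ?mulr0.
Qed.

Lemma integrable_mul_indic D g : measurable D ->
  mu.-integrable D (EFin \o g) -> mu.-integrable setT (EFin \o (fun x =>
    g x * \1_D x)).
Proof.
move=> mD /(integrable_mkcond (mu := mu) _ mD); congr integrable.
apply/funext => x; rewrite /= patchE indicE.
by case: (x \in D); rewrite ?mulr1 ?mulr0.
Qed.

Lemma haar_coefE g I : loc1 g -> haar_coef g I = hc (ig g) I.
Proof.
move=> [mg hg]; rewrite /haar_coef.
have il := integrable_mul_indic (@measurable_dset R (dleft I)) (hg _).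
have ir := integrable_mul_indic (@measurable_dset R (dright I)) (hg _).
transitivity (\int[mu]_x (s I * (g x * \1_(dset (dleft I)) x - g x * \1_(dset
  (dright I)) x))).
  by apply: eq_Rintegral => x _; rewrite /haar /s; ring.
rewrite RintegralZl//; last exact: integrableRB.
by rewrite RintegralB// !Rintegral_mul_indic.
Qed.

Lemma ig_vanish g I J : (forall x, ~ dset I x -> g x = 0) ->
  (dset I : set R) `<=` dset J -> ig g J = \int[mu]_x g x.
Proof.
move=> g0 IJ; rewrite /ig Rintegral_mkcond; apply: eq_Rintegral => x _.
by rewrite patchE; case: ifPn => // /negP xJ; rewrite g0// => /IJ/mem_set.
Qed.

Lemma ig_haar g I J : loc1 g -> (dset I : set R) `<=` dset J ->
  ig (fun x => g x * haar I x) J = hc (ig g) I.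
Proof.
move=> lg IJ; rewrite (ig_vanish _ IJ) -?haar_coefE// => x h.
by rewrite haar_out ?mulr0.
Qed.

Lemma ig_haar_avg g I J : loc1 g -> (dset I : set R) `<=` dset J ->
  ig (fun x => g x * haar_avg I x) J = ig g I / dlen I.
Proof.
move=> lg IJ; rewrite (ig_vanish _ IJ); last by move=> x h;
  rewrite haar_avg_out ?mulr0.
transitivity (\int[mu]_x ((dlen I)^-1 * (g x * \1_(dset I) x))).
  by apply: eq_Rintegral => x _; rewrite /haar_avg; ring.
rewrite RintegralZl ?Rintegral_mul_indic//; first by rewrite mulrC.
by apply: integrable_mul_indic; [exact: measurable_dset|case: lg].
Qed.

Lemma L2dot_haar_avg g I : loc1 g -> L2dot g (haar_avg I) = ig g I / dlen I.
Proof.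
move=> lg; rewrite -(ig_haar_avg lg (@subset_refl _ _)).
rewrite (@ig_vanish _ I)// => x h; by rewrite haar_avg_out ?mulr0.
Qed.

Lemma ig0 g J : (forall x, dset J x -> g x = 0) -> ig g J = 0.
Proof. by move=> g0; rewrite (@eq_ig _ _ (fun=> 0))// ig_cst mul0r. Qed.

Lemma hc_const (c : R) L : hc (ig (fun=> c)) L = 0.
Proof. by rewrite /hc !ig_cst dlen_left dlen_right subrr mulr0. Qed.

Lemma hc_cst (c : R) g L : loc1 g ->
  hc (ig (fun x => c * g x)) L = c * hc (ig g) L.
Proof. by move=> lg; rewrite /hc !igZ// -mulrBr mulrCA. Qed.

Lemma eq_hc f g L : (forall x, dset L x -> f x = g x) ->
  hc (ig f) L = hc (ig g) L.
Proof.
move=> fg; rewrite /hc (@eq_ig _ f g) ?[ig f (dright L)](@eq_ig _ f g)// => x h.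
- by apply: fg; exact: dset_right_sub.
- by apply: fg; exact: dset_left_sub.
Qed.

Lemma s_sqr I : s I * s I = (dlen I)^-1.
Proof. by rewrite -expr2 exprVn sqr_sqrtr// ltW// dlen_gt0. Qed.

Lemma disjoint_sub (A B C : set R) : A `&` B = set0 -> C `<=` B ->
  forall x, C x -> ~ A x.
Proof. by move=> AB CB x /CB Bx Ax; suff : set0 x by []; rewrite -AB. Qed.

Let ig_haar1 I J : (dset I : set R) `<=` dset J -> ig (haar I) J = 0 :> R.
Proof.
move=> IJ; have := ig_haar (loc2_loc1 (loc2_cst 1)) IJ.
under eq_fun do rewrite mul1r; move=> ->.
exact: hc_const.
Qed.

Let ig_haar_avg1 I J : (dset I : set R) `<=` dset J ->
  ig (haar_avg I) J = 1 :> R.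
Proof.
move=> IJ; have := ig_haar_avg (loc2_loc1 (loc2_cst 1)) IJ.
under eq_fun do rewrite mul1r; move=> ->.
by rewrite ig_cst mul1r mulfV// gt_eqF// dlen_gt0.
Qed.

(** The decomposition of multiplication by g into three paraproducts, tested on h_I and read off at
    the coefficient L: the terms are of type (0,0), (1,0) and (0,1), and at most one of them is
    nonzero for given I and L. *)
Lemma haar_product g I L : loc1 g ->
  hc (ig (fun x => g x * haar I x)) L =
  (if I == L then ig g L / dlen L else 0) +
    hc (ig g) I * hc (ig (haar_avg I)) L +
  hc (ig g) L * (ig (haar I) L / dlen L).
Proof.
move=> lg; have l0 := dlen_gt0 L : 0 < dlen L :> R.
(* L lies in a child of I, where h_I is constant: only the (0,1) term survives. *)
have inside (c : R) : (forall x, dset L x -> haar I x = c) ->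
    (dset L : set R) `<=` dset I -> (I == L) = false ->
    hc (ig (fun x => g x * haar I x)) L =
    (if I == L then ig g L / dlen L else 0) +
      hc (ig g) I * hc (ig (haar_avg I)) L +
    hc (ig g) L * (ig (haar I) L / dlen L).
  move=> hI LI ->.
  rewrite [LHS](@eq_hc _ (fun x => c * g x)); last by move=> x /hI ->;
    rewrite mulrC.
  rewrite hc_cst// (@eq_ig _ (haar I) (fun=> c))// ig_cst mulfK ?gt_eqF//.
  rewrite [hc (ig (haar_avg I)) L](@eq_hc _ (fun=> (dlen I)^-1));
    last by move=> x /LI /haar_avg_in.
  by rewrite hc_const; ring.
have neq : (dset L : set R) `<=` dset (dleft I) \/ (dset L : set R) `<=` dset
  (dright I) \/
    (dset I : set R) `<=` dset (dleft L) \/ (dset I : set R) `<=` dset (dright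
      L) ->
    (I == L) = false.
  move=> h; apply/eqP => IL; move: h; rewrite IL.
  have hl := dset_nonempty (dleft L) : dset (dleft L) (_ : R).
  have hr := dset_nonempty (dright L) : dset (dright L) (_ : R).
  have no (x : R) : dset (dleft L) x -> ~ dset (dright L) x.
    by move=> a b; suff : set0 x by []; rewrite -(dset_children_disjoint L).
  case=> [h|[h|[h|h]]].
  - by apply: (no _ (h _ (dset_right_sub hr))).
  - by apply: (no _ hl); apply: h; exact: dset_left_sub.
  - by apply: (no _ (h _ (dset_right_sub hr))).
  - by apply: (no _ hl); apply: h; exact: dset_left_sub.
(* I lies in a child of L: only the (1,0) term survives. a and b, one of them 1 and the other 0,
   tell which child. *)
have above (a b : R) : (I == L) = false -> 
    ig (fun x => g x * haar I x) (dleft L) = a * hc (ig g) I ->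
    ig (fun x => g x * haar I x) (dright L) = b * hc (ig g) I ->
    ig (haar_avg I) (dleft L) = a -> ig (haar_avg I) (dright L) = b ->
    ig (haar I) L = 0 :> R ->
    hc (ig (fun x => g x * haar I x)) L =
    (if I == L then ig g L / dlen L else 0) +
      hc (ig g) I * hc (ig (haar_avg I)) L +
    hc (ig g) L * (ig (haar I) L / dlen L).
  move=> -> h1 h2 h3 h4 h5; rewrite h5 [LHS]/hc h1 h2.
  by rewrite [hc (ig (haar_avg I)) L]/hc h3 h4; ring.
have [dis|->|[h|h|h|h]] := @dset_trichotomy R I L.
- have out x : dset L x -> ~ dset I x :=
  @disjoint_sub _ _ _ dis (@subset_refl _ _) x.
  have nIL : (I == L) = false.
    apply/eqP => IL; move: dis; rewrite IL setIid => e.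
    by have := @dset_nonempty R L; rewrite e.
  rewrite nIL [LHS](@eq_hc _ (fun=> 0)); last first.
    by move=> x /out /haar_out ->; rewrite mulr0.
  rewrite [ig (haar I) L]ig0; last by move=> x /out /haar_out.
  rewrite [hc (ig (haar_avg I)) L](@eq_hc _ (fun=> 0));
    last by move=> x /out /haar_avg_out.
  by rewrite !hc_const; ring.
- rewrite eqxx ig_haar1// mul0r mulr0 addr0.
  rewrite [hc (ig (haar_avg L)) L](@eq_hc _ (fun=> (dlen L)^-1));
    last exact: haar_avg_in.
  rewrite hc_const mulr0 addr0 /hc (@eq_ig _ _ (fun x => s L * g x) (dleft L));
    last first.
    by move=> x /haar_left ->; rewrite mulrC.
  rewrite (@eq_ig _ _ (fun x => - s L * g x) (dright L)); last first.
    by move=> x /haar_right ->; rewrite mulrC.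
  rewrite !igZ// -/(s L) (ig_dadditive lg L) mulNr opprK -mulrDr mulrA s_sqr.
  by rewrite mulrC.
- have out x : dset (dright L) x -> ~ dset I x.
    move=> hr /h hl; suff : set0 x by [].
    by rewrite -(dset_children_disjoint L).
  apply: (above 1 0).
  + by apply: neq; right; right; left.
  + by rewrite ig_haar// mul1r.
  + by rewrite mul0r; apply: ig0 => x /out /haar_out ->; rewrite mulr0.
  + exact: ig_haar_avg1.
  + by apply: ig0 => x /out /haar_avg_out.
  + apply: ig_haar1; exact: subset_trans (@dset_left_sub _ L).
- have out x : dset (dleft L) x -> ~ dset I x.
    move=> hl /h hr; suff : set0 x by [].
    by rewrite -(dset_children_disjoint L).
  apply: (above 0 1).
  + by apply: neq; right; right; right.
  + by rewrite mul0r; apply: ig0 => x /out /haar_out ->; rewrite mulr0.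
  + by rewrite ig_haar// mul1r.
  + by apply: ig0 => x /out /haar_avg_out.
  + exact: ig_haar_avg1.
  + apply: ig_haar1; exact: subset_trans (@dset_right_sub _ L).
- apply: (inside (s I)).
  + by move=> x /h /haar_left.
  + exact: subset_trans (@dset_left_sub _ I).
  + by apply: neq; left.
- apply: (inside (- s I)).
  + by move=> x /h /haar_right.
  + exact: subset_trans (@dset_right_sub _ I).
  + by apply: neq; right; left.
Qed.

Lemma hc_haar I L : hc (ig (haar I : R -> R)) L = (I == L)%:R.
Proof.
have := haar_product I L (loc2_loc1 (loc2_cst (1 : R))).
under eq_fun do rewrite mul1r; move=> ->.
rewrite !hc_const !mul0r !addr0 ig_cst mul1r mulfV ?gt_eqF ?dlen_gt0//.
by case: eqP.
Qed.

End HaarCalculus.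

(** * Completeness of the Haar system *)

Section Parseval.
Context {R : realType}.
Local Notation mu := (@lebesgue_measure R).
Implicit Types (I J K L : dyadic) (f g u v : R -> R) (x : R).

Definition dyadic_at (k : int) x : dyadic := (k, Num.floor (x / 2 ^ k)).

(** Conditional expectation on the dyadic intervals of length 2^k. *)
Definition cexp u (k : int) x : R :=
  ig u (dyadic_at k x) / dlen (dyadic_at k x).

Lemma dyadic_at_in k x : dset (dyadic_at k x) x.
Proof. by rewrite dset_floor. Qed.

Lemma dyadic_atE J x : dset J x -> dyadic_at J.1 x = J.
Proof. by rewrite dset_floor /dlen /dyadic_at; case: J => k j /= <-. Qed.

Definition haar_mass u n J : R :=
  \sum_(K <- tree n J) hc (ig u) K ^+ 2 + ig u J ^+ 2 / dlen J.

(** Parseval on a finite tree, by one application of [hc_parallelogram] per generation. *)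
Lemma integral_cexp_sqr u n (k : int) J : loc1 u -> J.1 = k + n%:Z ->
  measurable_fun (dset J) (cexp u k) /\
  (\int[mu]_(x in dset J) (cexp u k x ^+ 2)%:E = (haar_mass u n J)%:E)%E.
Proof.
move=> lu; elim: n J => [|n IH] J Jk.
  have cE x : dset J x -> cexp u k x = ig u J / dlen J.
    by move=> /dyadic_atE; rewrite Jk addr0 /cexp => ->.
  split.
    apply: (eq_measurable_fun (fun=> ig u J / dlen J)) => // x.
    by rewrite inE => /cE.
  rewrite (eq_integral (fun=> ((ig u J / dlen J) ^+ 2)%:E)); last first.
    by move=> x; rewrite inE => /cE ->.
  rewrite integral_cst /haar_mass ?big_nil; last exact: measurable_dset.
  transitivity (((ig u J / dlen J) ^+ 2)%:E * (dlen J)%:E)%E.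
    by congr (_ * _)%E; exact: lebesgue_measure_dset.
  rewrite -EFinM add0r; congr (_%:E).
  by field; rewrite gt_eqF// dlen_gt0.
have [ml il] : _ /\ _ := IH (dleft J) ltac:(rewrite /= Jk; lia).
have [mr ir] : _ /\ _ := IH (dright J) ltac:(rewrite /= Jk; lia).
have mJ : measurable_fun (dset J) (cexp u k).
  rewrite dset_children; apply/measurable_funU => //; exact: measurable_dset.
split => //; rewrite [in LHS]dset_children ge0_integral_setU.
- rewrite -[RHS]/((haar_mass u n.+1 J)%:E) (_ : haar_mass u n.+1 J =
    haar_mass u n (dleft J) + haar_mass u n (dright J)); last first.
    rewrite /haar_mass /= big_cons big_cat /=.
    have := hc_parallelogram J (ig_dadditive lu); lra.
  by rewrite EFinD; congr (_ + _)%E.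
- exact: measurable_dset.
- exact: measurable_dset.
- rewrite -dset_children; apply/measurable_EFinP; exact: measurable_funX.
- by move=> x _; rewrite lee_fin sqr_ge0.
- by apply/disj_set2P; exact: dset_children_disjoint.
Qed.

(** Dyadic intervals around x shrink nicely: each lies in the ball about x whose radius is its
    length, and fills half of that ball. *)
Lemma cexp_cvg u J : loc1 u ->
  {ae mu, forall x, dset J x -> cexp u (J.1 - n%:Z) x @[n --> \oo] --> u x}.
Proof.
move=> lu; pose E x n := dset (dyadic_at (J.1 - n%:Z) x) : set R.
(* The cut-off is integrable on the line and has the same averages as u inside J. *)
pose v := u \_ (dset J).
have lv : locally_integrable setT v.
  by apply: integrable_locally_restrict; [exact: measurable_dset|case: lu].
have len n : 2 ^ (J.1 - n%:Z) = dlen J * (2^-1) ^+ n :> R.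
  by rewrite expfzDr ?pnatr_eq0// -exprz_inv.
have nE x : nicely_shrinking x (E x).
  split; first by move=> n; exact: measurable_dset.
  exists (2, fun n => PosNum (dlen_gt0 (dyadic_at (J.1 - n%:Z) x)));
    split => //=.
  - rewrite (_ : (fun _ => _) = fun n => dlen J * (2^-1) ^+ n); last first.
      by apply/funext => n; rewrite /dlen /= len.
    rewrite -[X in _ --> X](mulr0 (dlen J)); apply: cvgMr.
    by apply: cvg_expr; rewrite ger0_norm ?invr_ge0// invf_lt1// ltr1n.
  - move=> n y; rewrite /E; have := dyadic_at_in (J.1 - n%:Z) x; rewrite !dsetE.
    move=> /andP[h1 h2] /andP[h3 h4]; rewrite /ball /= ltr_norml.
    by move: h1 h2 h3 h4; rewrite !intrD !mulrDl mul1r => *; apply/andP; split;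
      lra.
  - move=> n; rewrite lebesgue_measure_ball; last exact/ltW/dlen_gt0.
    apply: le_trans (_ : 2%:E * (dlen (dyadic_at (J.1 - n%:Z) x))%:E <= _)%E.
      by rewrite -EFinM lee_fin mulr_natl.
    by rewrite le_eqVlt -(@lebesgue_measure_dset R) eqxx.
have [N [mN N0 sub]] := lebesgue_differentiation lv.
exists N; split => // x /= h; apply: sub => /= lx; apply: h => {N mN N0} Jx.
have cv := nice_lebesgue_differentiation nE lv lx.
have vx : v x = u x by rewrite /v patchE mem_set.
move: cv; rewrite vx => /fine_cvg; apply: cvg_trans.
apply: near_eq_cvg; apply: nearW => n /=.
have sub : E x n `<=` dset J.
  have [//|dis] := @dset_nest R (dyadic_at (J.1 - n%:Z) x) J ltac:(rewrite /=
    gerBl//).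
  suff : set0 x by [].
  by rewrite -dis; split => //; exact: dyadic_at_in.
have -> : (\int[mu]_(y in E x n) (v y)%:E =
  (ig u (dyadic_at (J.1 - n%:Z) x))%:E)%E.
  rewrite fineK; last first.
    apply: integrable_fin_num; first exact: measurable_dset.
    by case: lu => _; exact.
  apply: eq_integral => y; rewrite inE => /sub Jy.
  by rewrite /v patchE mem_set.
transitivity (fine (((dlen (dyadic_at (J.1 - n%:Z) x))%:E)^-1 *
    (ig u (dyadic_at (J.1 - n%:Z) x))%:E)%E).
  by congr (fine (_^-1 * _)%E); exact: lebesgue_measure_dset.
by rewrite inver gt_eqF ?dlen_gt0//= mulrC.
Qed.

Lemma limn_einf_le_cst (c : \bar R) (a : nat -> \bar R) :
  (forall n, (a n <= c)%E) -> (limn_einf a <= c)%E.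
Proof.
move=> ac; apply: le_trans (limn_einf_sup a) _; rewrite limn_esup_lim.
apply: lime_le; first exact: is_cvg_esups.
by apply: nearW => n; apply: ge_ereal_sup => _ [k _ <-].
Qed.

(* Fatou's lemma for the dyadic averages of u, which converge to u almost
   everywhere by the Lebesgue differentiation theorem. *)
Lemma haar_mass_sup u J (e : R) : loc2 u -> 0 < e ->
  exists n, ig (fun x => u x ^+ 2) J - e < haar_mass u n J.
Proof.
move=> lu e0; apply: contrapT => /forallNP h.
have lu1 := loc2_loc1 lu.
have {}h n : haar_mass u n J <= ig (fun x => u x ^+ 2) J - e.
  by rewrite leNgt; apply/negP/h.
have [N [mN N0 sub]] := cexp_cvg J lu1.
pose D := dset J `\` N : set R.
have mJ : measurable (dset J : set R) := measurable_dset J.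
have mD : measurable D by exact: measurableD.
pose a n x := ((cexp u (J.1 - n%:Z) x) ^+ 2)%:E.
have Jn n : J.1 = (J.1 - n%:Z) + n%:Z by rewrite subrK.
have ma n : measurable_fun (dset J) (a n).
  apply/measurable_EFinP; apply: measurable_funX.
  by case: (integral_cexp_sqr lu1 (Jn n)).
have := @fatou _ _ _ mu D mD a.
have lim x : D x -> limn_einf (a ^~ x) = (u x ^+ 2)%:E.
  move=> [Jx Nx]; apply: (cvg_limn_einf_sup _).1.
  apply: cvg_EFin; first exact: nearW.
  have : cexp u (J.1 - n%:Z) x @[n --> \oo] --> u x.
    by apply: contrapT => no; apply: Nx; apply: sub => /= /(_ Jx).
  by move=> cv; rewrite expr2; apply: cvgM.
have aD n : measurable_fun D (a n) by apply: measurable_funS (ma n) => //;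
  exact: subDsetl.
have a0 n x : D x -> (0 <= a n x)%E by rewrite lee_fin sqr_ge0.
have hJ : mu.-integrable (dset J) (EFin \o (fun x => u x ^+ 2)) by case: lu.
move=> /(_ aD a0).
have -> : (\int[mu]_(x in D) limn_einf (a ^~ x) =
  \int[mu]_(x in D) (u x ^+ 2)%:E)%E.
  by apply: eq_integral => x; rewrite inE => /lim.
have -> : (\int[mu]_(x in D) (u x ^+ 2)%:E = (ig (fun x => u x ^+ 2) J)%:E)%E.
  rewrite -(@negligible_integral _ _ _ mu (dset J) N)//.
  by rewrite fineK//; exact: integrable_fin_num.
apply/negP; rewrite -ltNge.
apply: le_lt_trans (_ : (ig (fun x => u x ^+ 2) J - e)%:E < _)%E; last first.
  by rewrite lte_fin ltrBlDr ltrDl.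
apply: limn_einf_le_cst => n; apply: le_trans (_ : (haar_mass u n J)%:E <= _)%E.
  have [_ <-] := integral_cexp_sqr lu1 (Jn n).
  apply: ge0_subset_integral => //.
  - exact: ma.
  - by move=> x _; rewrite lee_fin sqr_ge0.
  - exact: subDsetl.
by have := h n; rewrite -lee_fin.
Qed.

End Parseval.

(** * Haar expansion of square integrable functions of bounded support *)

Section Expansion.
Context {R : realType}.
Local Notation mu := (@lebesgue_measure R).
Implicit Types (I J K L : dyadic) (f g u v : R -> R) (x : R) (m : int).

Lemma L2P f : L2 f <-> sqr_integrable setT f.
Proof.
split=> [h|[mf if2]].
  split; last exact: Lfun2_integrable_sqr.
  by move: h; rewrite /L2 inE => /andP[]; rewrite inE.
rewrite /L2 inE; apply/andP; split; rewrite inE//=.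
rewrite /finite_norm unlock /Lnorm poweR_lty//.
have := integrable_lty measurableT if2; apply: le_lt_trans.
rewrite le_eqVlt; apply/orP; left; apply/eqP; apply: eq_integral => x _ /=.
by rewrite powR_mulrn// real_normK// num_real.
Qed.

Lemma L2normE f : sqr_integrable setT f ->
  L2norm f = (Num.sqrt (\int[mu]_x (f x ^+ 2)))%:E.
Proof.
move=> [mf if2]; rewrite /L2norm unlock /Lnorm.
have -> : (\int[mu]_x ((`|f x| `^ 2)%:E) = (\int[mu]_x (f x ^+ 2))%:E)%E.
  rewrite fineK; last exact: integrable_fin_num.
  apply: eq_integral => x _ /=.
  by rewrite powR_mulrn// real_normK// num_real.
rewrite poweR_EFin powR12_sqrt// Rintegral_ge0// => x _; exact: sqr_ge0.
Qed.

Definition supported m u := forall x, ~ (- 2 ^ m <= x < 2 ^ m) -> u x = 0.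

Lemma dset_top m x : dset (m, 0) x = (0 <= x < 2 ^ m) :> Prop.
Proof. by rewrite dsetE /dlen/= mul0r mul1r. Qed.

Lemma dset_bottom m x : dset (m, -1) x = (- 2 ^ m <= x < 0) :> Prop.
Proof. by rewrite dsetE /dlen/= mulN1r addNr mul0r. Qed.

Lemma dset_tops m x : (- 2 ^ m <= x < 2 ^ m) -> dset (m, 0) x \/ dset (m, -1) x.
Proof.
rewrite dset_top dset_bottom => /andP[h1 h2].
by have [h|h] := leP 0 x; [left|right]; apply/andP.
Qed.

Lemma tops_disjoint m m' : dset (m, 0) `&` dset (m', -1) = set0 :> set R.
Proof.
apply/seteqP; split => // x []; rewrite dset_top dset_bottom.
by move=> /andP[h1 _] /andP[_ h2]; move: (lt_le_trans h2 h1); rewrite ltxx.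
Qed.

Lemma supportedW m (p : nat) u : supported m u -> supported (m + p%:Z) u.
Proof.
move=> su x h; apply: su => /andP[h1 h2]; apply: h.
have : 2 ^ m <= 2 ^ (m + p%:Z) :> R by rewrite ler_eXz2l ?ltr1n ?lerDl.
by move=> h3; apply/andP; split; lra.
Qed.

Lemma supported_integral m g : loc1 g -> supported m g ->
  mu.-integrable setT (EFin \o g) /\ \int[mu]_x g x = ig g (m, 0) + ig g (m,
    -1).
Proof.
move=> lg sg.
have gE : g = fun x => g x * \1_(dset (m, 0)) x + g x * \1_(dset (m, -1)) x.
  apply/funext => x; rewrite !indicE.
  have [/dset_tops[h|h]|h] := pselect (- 2 ^ m <= x < 2 ^ m).
  - rewrite mem_set// memNset ?mulr1 ?mulr0 ?addr0// => h'.
    by suff : set0 x by []; rewrite -(tops_disjoint m m).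
  - rewrite memNset ?mem_set ?mulr1 ?mulr0 ?add0r// => h'.
    by suff : set0 x by []; rewrite -(tops_disjoint m m).
  - by rewrite (sg _ h) !mul0r addr0.
have i1 := integrable_mul_indic (@measurable_dset R (m, 0)) (lg.2 _).
have i2 := integrable_mul_indic (@measurable_dset R (m, -1)) (lg.2 _).
split; first by rewrite gE; exact: integrableRD.
by rewrite [in LHS]gE RintegralD// !Rintegral_mul_indic.
Qed.

Lemma supported_sqr m u : loc2 u -> supported m u ->
  sqr_integrable setT u /\
  \int[mu]_x (u x ^+ 2) = ig (fun x => u x ^+ 2) (m, 0) + ig (fun x =>
    u x ^+ 2) (m, -1).
Proof.
move=> lu su.
have s2 : supported m (fun x => u x ^+ 2) by move=> x /su ->; rewrite expr0n.
have [i2 e2] := supported_integral (loc2_sqr lu) s2.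
by split => //; split => //; case: lu.
Qed.

Lemma tops_bounded n n' m I x : I \in tree n (m, 0) ++ tree n' (m, -1) ->
  dset I x -> - 2 ^ m <= x < 2 ^ m.
Proof.
have m0 : 0 <= 2 ^ m :> R by rewrite exprz_ge0.
rewrite mem_cat => /orP[] /tree_dset Im /Im.
  by rewrite dset_top => /andP[h1 ->]; rewrite andbT (le_trans _ h1)// oppr_le0.
by rewrite dset_bottom => /andP[-> h2] /=; rewrite (lt_le_trans h2).
Qed.

Lemma seq_in_tree (s : seq dyadic) : exists M : int, exists N : nat,
  forall (p n : nat), (N + p <= n)%N ->
    {subset s <= tree n (M + p%:Z, 0) ++ tree n (M + p%:Z, -1)}.
Proof.
elim: s => [|I s [M [N IH]]]; first by exists 0, 0%N => p n _ I.
have [M' [N' h]] := dyadic_in_tree I.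
pose p1 := `|Num.max M M' - M|%N; pose p2 := `|Num.max M M' - M'|%N.
have e1 : Num.max M M' = M + p1%:Z by rewrite /p1; lia.
have e2 : Num.max M M' = M' + p2%:Z by rewrite /p2; lia.
exists (Num.max M M'), (N + p1 + (N' + p2))%N => p n Nn K;
  rewrite inE => /orP[/eqP->|Ks].
  rewrite e2 -addrA -PoszD; apply: h; lia.
rewrite e1 -addrA -PoszD; apply: IH => //; lia.
Qed.

Lemma haar_supported I : exists m, supported m (haar I : R -> R).
Proof.
have [m [N /(_ 0%N N)]] := dyadic_in_tree I;
  rewrite addn0 addr0 => /(_ (leqnn _)) Im.
by exists m => x nx; apply: haar_out => /(tops_bounded Im).
Qed.

Lemma sqr_integrable_haar I : sqr_integrable setT (haar I : R -> R).
Proof.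
have [m h] := haar_supported I.
by have [] := supported_sqr (loc2_haar I) h.
Qed.

Lemma sqr_integrableT_loc2 u : sqr_integrable setT u -> loc2 u.
Proof.
move=> [mu' iu]; split => // I.
by apply: integrableS iu => //; exact: measurable_dset.
Qed.

Lemma dot_haar u I : sqr_integrable setT u ->
  \int[mu]_x (u x * haar I x) = hc (ig u) I.
Proof. by move=> /sqr_integrableT_loc2/loc2_loc1/haar_coefE <-. Qed.

Definition haar_sum (c : dyadic -> R) (s : seq dyadic) : R -> R :=
  fun x => \sum_(I <- s) c I * haar I x.

Lemma sqr_integrable_haar_sum c s : sqr_integrable setT (haar_sum c s).
Proof.
apply: sqr_integrable_sum => // I; apply: sqr_integrableZ => //.
exact: sqr_integrable_haar.
Qed.

Lemma dot_haar_sum c s v : sqr_integrable setT v ->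
  \int[mu]_x (haar_sum c s x * v x) = \sum_(I <- s) c I * hc (ig v) I.
Proof.
move=> hv; elim: s => [|I s IH].
  rewrite big_nil (@eq_Rintegral _ _ _ _ _ (fun=> 0)).
    by rewrite Rintegral_cst// mul0r.
  by move=> x _; rewrite /haar_sum big_nil mul0r.
rewrite big_cons -IH -dot_haar//.
rewrite -RintegralZl//; last exact: sqr_integrableM (sqr_integrable_haar I).
rewrite -RintegralD//.
- by apply: eq_Rintegral => x _; rewrite /haar_sum big_cons; ring.
- by apply: integrableRZ => //; exact: sqr_integrableM (sqr_integrable_haar I).
- by apply: sqr_integrableM => //; exact: sqr_integrable_haar_sum.
Qed.

Lemma pythagoras u s : sqr_integrable setT u -> uniq s ->
  \int[mu]_x ((u x - haar_sum (hc (ig u)) s x) ^+ 2) =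
  \int[mu]_x (u x ^+ 2) - \sum_(I <- s) hc (ig u) I ^+ 2.
Proof.
move=> hu us; set w := haar_sum _ s.
have hw : sqr_integrable setT w by exact: sqr_integrable_haar_sum.
have uw := sqr_integrableM measurableT hu hw.
have -> : \int[mu]_x ((u x - w x) ^+ 2) =
    \int[mu]_x (u x ^+ 2) - 2 * (\int[mu]_x (w x * u x)) +
      \int[mu]_x (w x * w x).
  rewrite -RintegralZl//; last exact: sqr_integrableM.
  rewrite -RintegralB//; last 2 first.
  - by case: hu.
  - by apply: integrableRZ => //; exact: sqr_integrableM.
  rewrite -RintegralD//.
  - by apply: eq_Rintegral => x _; ring.
  - apply: integrableRB => //; first by case: hu.
    by apply: integrableRZ => //; exact: sqr_integrableM.
  - exact: sqr_integrableM.
rewrite !dot_haar_sum//.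
have hcw I : I \in s -> hc (ig w) I = hc (ig u) I.
  move=> Is; rewrite -dot_haar// dot_haar_sum; last exact: sqr_integrable_haar.
  rewrite (bigD1_seq I)//= big1 ?addr0; last first.
    by move=> J JI; rewrite hc_haar eq_sym (negbTE JI) mulr0.
  by rewrite hc_haar eqxx mulr1.
have -> : \sum_(I <- s) hc (ig u) I * hc (ig w) I =
  \sum_(I <- s) hc (ig u) I ^+ 2.
  by rewrite big_seq [RHS]big_seq; apply: eq_bigr => I Is; rewrite hcw.
have -> : \sum_(I <- s) hc (ig u) I * hc (ig u) I =
  \sum_(I <- s) hc (ig u) I ^+ 2.
  by [].
ring.
Qed.

Lemma sum_subset_le (A : eqType) (s t : seq A) (f : A -> R) :
  uniq s -> {subset s <= t} -> (forall a, 0 <= f a) ->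
  \sum_(a <- s) f a <= \sum_(a <- t) f a.
Proof.
move=> + + f0; elim: s t => [|a s IH] t /=; first by rewrite big_nil sumr_ge0.
move=> /andP[nas us] st; have at_ : a \in t by apply: st; rewrite mem_head.
rewrite big_cons (big_rem a at_) /= lerD// IH// => b bs.
have bt : b \in t by apply: st; rewrite inE bs orbT.
by apply: rem_mem => //; apply: contraNneq nas => <-.
Qed.

Lemma ig_top u m (p : nat) : loc1 u -> supported m u ->
  ig u (m + p%:Z, 0) = ig u (m, 0) /\ ig u (m + p%:Z, -1) = ig u (m, -1).
Proof.
move=> lu su; elim: p => [|p [IH0 IH1]]; first by rewrite addr0.
have sp := supportedW (p := p) su; split.
  rewrite (ig_dadditive lu) /dleft /dright /= mulr0 add0r.
  have -> : m + p.+1%:Z - 1 = m + p%:Z by lia.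
  rewrite IH0 [X in _ + X]ig0 ?addr0// => x.
  rewrite dsetE /dlen /= => /andP[h _]; apply: sp => /andP[_].
  by rewrite ltNge -[X in (X <= _)%R]mul1r h.
rewrite (ig_dadditive lu) /dleft /dright /=.
have -> : m + p.+1%:Z - 1 = m + p%:Z by lia.
have -> : 2 * -1 + 1 = -1 :> int by [].
rewrite IH1 [X in X + _]ig0 ?add0r// => x.
rewrite dsetE /dlen /= => /andP[_ h]; apply: sp => /andP[h' _].
move: h; have -> : (2 * -1 + 1)%:~R = -1 :> R by [].
by rewrite mulN1r => h; move: (lt_le_trans h h'); rewrite ltxx.
Qed.

Lemma uniq_trees n n' m : uniq (tree n (m, 0) ++ tree n' (m, -1)).
Proof.
rewrite cat_uniq; apply/and3P; split; rewrite ?uniq_tree//.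
apply/hasPn => K K1; apply/negP => K0.
have x0 := dset_nonempty K : dset K (_ : R).
have : (dset (m, 0) `&` dset (m, -1)) (K.2%:~R * dlen K : R).
  by split; [exact: tree_dset K0 _ x0|exact: tree_dset K1 _ x0].
by rewrite tops_disjoint.
Qed.

(** The trees under the two roots miss the means over the roots. Enlarging the roots leaves the
    integrals of u unchanged ([ig_top]), so the energy of these means, integral squared over length,
    tends to 0. *)
Lemma haar_expansion m u : loc2 u -> supported m u ->
  L2_sum (fun I x => hc (ig u) I * haar I x) u.
Proof.
move=> lu su; have lu1 := loc2_loc1 lu; have [hu _] := supported_sqr lu su.
split; first exact/L2P.
(* One quarter for the tail at each of the two roots, one for the means, one to spare. *)
move=> e e0; pose d := e ^+ 2 / 4; have d0 : 0 < d by rewrite divr_gt0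
  ?exprn_gt0.
pose A := ig u (m, 0) ^+ 2 + ig u (m, -1) ^+ 2.
have A0 : 0 <= A by rewrite addr_ge0 ?sqr_ge0.
have [p pA] : exists p : nat, A / 2 ^ (m + p%:Z) <= d.
  have l0 : 0 < 2 ^ m :> R by rewrite exprz_gt0.
  exists (Num.bound (A / (2 ^ m * d))).
  set p := Num.bound _; rewrite expfzDr ?pnatr_eq0//.
  have h1 : A / (2 ^ m * d) < p%:R by apply: archi_boundP;
    rewrite divr_ge0// mulr_ge0 ?ltW.
  have h2 : p%:R <= 2 ^+ p :> R by rewrite -natrX ler_nat ltnW// ltn_expl.
  rewrite ler_pdivrMr ?mulr_gt0 ?exprz_gt0//.
  move: h1; rewrite ltr_pdivrMr ?mulr_gt0// => h1; apply: le_trans (ltW h1) _.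
  have h3 := ler_wpM2r (ltW (mulr_gt0 l0 d0)) h2.
  have shuffle (a b c : R) : b * (a * c) = c * (a * b) by ring.
  by apply: le_trans h3 _; rewrite -exprnP shuffle.
have [e00 e01] := ig_top p lu1 su.
have sp := supportedW (p := p) su.
have [_ uE] := supported_sqr lu sp.
have [n0 h0] := haar_mass_sup (m + p%:Z, 0) lu d0.
have [n1 h1] := haar_mass_sup (m + p%:Z, -1) lu d0.
pose s := tree n0 (m + p%:Z, 0) ++ tree n1 (m + p%:Z, -1).
exists [fset I in s]%fset => F sF.
have hd : sqr_integrable setT (fun x => u x - haar_sum (hc (ig u)) F x).
  have := sqr_integrableD measurableT hu (sqr_integrableZ (-1) measurableT
     (sqr_integrable_haar_sum (hc (ig u)) F)).
  by congr sqr_integrable; apply/funext => x; rewrite mulN1r.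
rewrite L2normE// lte_fin pythagoras ?fset_uniq//.
have sub : \sum_(I <- s) hc (ig u) I ^+ 2 <= \sum_(I <- F) hc (ig u) I ^+ 2.
  apply: sum_subset_le; [exact: uniq_trees| |by move=> I; exact: sqr_ge0].
  by move=> I Is; apply: (fsubsetP sF); rewrite in_fset.
rewrite -[ltRHS]ger0_norm ?(ltW e0)// -sqrtr_sqr ltr_sqrt ?exprn_gt0//.
move: h0 h1 sub pA; rewrite /haar_mass /s big_cat uE e00 e01 /=.
rewrite /dlen /= /A mulrDl.
have de : e ^+ 2 = 4 * d by rewrite /d; field.
rewrite de; lra.
Qed.

End Expansion.

(** * The form of the Haar shift *)

Section Shift.
Context {R : realType}.
Local Notation mu := (@lebesgue_measure R).
Implicit Types (I J K L : dyadic) (f g u v : R -> R) (x : R).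

Lemma Rintegral_ae_eq f g v : sqr_integrable setT f -> sqr_integrable setT g ->
    sqr_integrable setT v -> f = g %[ae mu] ->
  \int[mu]_x (f x * v x) = \int[mu]_x (g x * v x).
Proof.
move=> [mf _] [mg _] [mv _] fg; congr fine; apply: ae_eq_integral => //.
- by apply/measurable_EFinP; exact: measurable_funM.
- by apply/measurable_EFinP; exact: measurable_funM.
- case: fg => N [mN N0 sub]; exists N; split => // x /= h; apply: sub => /= e.
  by apply: h => _; rewrite (e I).
Qed.

Variable S : (R -> R) -> (R -> R).
Hypothesis haarS : is_haar_shift S.

Let S_L2 f : sqr_integrable setT f -> sqr_integrable setT (S f).
Proof. by case: haarS => -[h _ _] _ /L2P/h/L2P. Qed.

Let shift_form v f := \int[mu]_x (S f x * v x).

Let shift_formD v c f g : sqr_integrable setT v -> sqr_integrable setT f ->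
    sqr_integrable setT g ->
  shift_form v (fun x => c * f x + g x) = c * shift_form v f + shift_form v g.
Proof.
move=> hv hf hg; case: haarS => -[_ lin _] _.
have hcf := sqr_integrableZ c measurableT hf.
have hSf := sqr_integrableZ c measurableT (S_L2 hf).
have := lin c f g ((L2P f).2 hf) ((L2P g).2 hg).
rewrite /shift_form => /Rintegral_ae_eq -> //; last 2 first.
- by apply: S_L2; exact: sqr_integrableD.
- by apply: sqr_integrableD => //; exact: S_L2.
rewrite -RintegralZl//; last by apply: sqr_integrableM => //; exact: S_L2.
rewrite -RintegralD//.
- by apply: eq_Rintegral => x _; ring.
- by apply: integrableRZ => //; apply: sqr_integrableM => //; exact: S_L2.
- by apply: sqr_integrableM => //; exact: S_L2.
Qed.

Let shift_form_haar v I : sqr_integrable setT v ->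
  shift_form v (haar I) = hc (ig v) (dleft I) - hc (ig v) (dright I).
Proof.
move=> hv; case: haarS => _ /(_ I) e.
have hl := sqr_integrable_haar (dleft I) :
  sqr_integrable setT (haar _ : R -> R).
have hr := sqr_integrable_haar (dright I) :
  sqr_integrable setT (haar _ : R -> R).
have hd : sqr_integrable setT (fun x : R =>
  haar (dleft I) x - haar (dright I) x).
  have := sqr_integrableD measurableT hl (sqr_integrableZ (-1) measurableT hr).
  by congr sqr_integrable; apply/funext => x; rewrite mulN1r.
rewrite /shift_form (Rintegral_ae_eq _ hd hv e);
  last exact/S_L2/sqr_integrable_haar.
rewrite -!dot_haar// -RintegralB//; last 2 first.
- exact: sqr_integrableM.
- exact: sqr_integrableM.
by apply: eq_Rintegral => x _; ring.
Qed.

Let shift_form_sum v c s : sqr_integrable setT v ->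
  shift_form v (haar_sum c s) =
  \sum_(I <- s) c I * (hc (ig v) (dleft I) - hc (ig v) (dright I)).
Proof.
move=> hv; elim: s => [|I s IH].
  have h0 := sqr_integrable_haar_sum c [::] : sqr_integrable setT (_ : R -> R).
  have := shift_formD (-1) hv h0 h0; rewrite mulN1r addNr big_nil => <-.
  by congr shift_form; apply/funext => x; rewrite /haar_sum big_nil mulr0 addr0.
rewrite big_cons -IH -shift_form_haar// -shift_formD//.
- by congr shift_form; apply/funext => x; rewrite /haar_sum big_cons.
- exact: sqr_integrable_haar.
- exact: sqr_integrable_haar_sum.
Qed.

(** Only u is expanded. On a finite Haar sum the shift pairs the coefficient at I with those of v at
    the children of I; the remainder is small in L^2, and boundedness of S with Cauchy-Schwarz makes
    its form small. *)
Lemma shift_form_le u v m (K : R) : loc2 u -> supported m u ->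
  sqr_integrable setT v ->
  (forall F : {fset dyadic}, \sum_(I <- F) `|hc (ig u) I| *
     (`|hc (ig v) (dleft I)| + `|hc (ig v) (dright I)|) <= K) ->
  `|L2dot (S u) v| <= K.
Proof.
move=> lu su hv HK; have [hu _] := supported_sqr lu su.
have [_ expn] := haar_expansion lu su.
case: haarS => -[_ _ [M hM]] _.
pose V := Num.sqrt (\int[mu]_x (v x ^+ 2)).
have V0 : 0 <= V by exact: sqrtr_ge0.
(* The sign of M is unknown; the 1 added to M' V below keeps the denominator positive. *)
pose M' := Num.max M 0.
have M0 : 0 <= M' by rewrite le_max lexx orbT.
apply/ler_addgt0Pr => e e0.
have d0 : 0 < e / (M' * V + 1) by rewrite divr_gt0// ltr_wpDl// mulr_ge0.
have [F0 /(_ F0 (fsubset_refl _))] := expn _ d0.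
set w := fun x => _ - _.
have hs := sqr_integrable_haar_sum (hc (ig u)) F0.
have hw : sqr_integrable setT w.
  have := sqr_integrableD measurableT hu (sqr_integrableZ (-1) measurableT hs).
  by congr sqr_integrable; apply/funext => x; rewrite mulN1r.
rewrite L2normE// lte_fin => wd.
have -> : L2dot (S u) v = shift_form v (haar_sum (hc (ig u)) F0) +
  shift_form v w.
  rewrite -[X in X + _]mul1r -shift_formD//; congr shift_form.
  by apply/funext => x; rewrite /w mul1r addrC subrK.
apply: le_trans (ler_normD _ _) _; apply: lerD.
  rewrite shift_form_sum//; apply: le_trans (HK F0).
  apply: le_trans (ler_norm_sum _ _ _) _; apply: ler_sum => I _.
  by rewrite normrM ler_wpM2l// ler_normB.
have SwL : Num.sqrt (\int[mu]_x (S w x ^+ 2)) <=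
  M' * Num.sqrt (\int[mu]_x (w x ^+ 2)).
  have := hM w ((L2P w).2 hw).
  rewrite !L2normE//; last exact: S_L2.
  rewrite -EFinM lee_fin => /le_trans; apply; apply: ler_wpM2r;
    first exact: sqrtr_ge0.
  by rewrite le_max lexx.
have CS := Rintegral_CS measurableT (S_L2 hw) hv.
have -> : `|shift_form v w| = Num.sqrt (shift_form v w ^+ 2) by rewrite
  sqrtr_sqr.
apply: le_trans (_ : Num.sqrt (\int[mu]_x (S w x ^+ 2)) * V <= _).
  rewrite -sqrtrM; last by apply: Rintegral_ge0 => x _; exact: sqr_ge0.
  by rewrite ler_wsqrtr.
apply: le_trans (ler_wpM2r V0 SwL) _.
apply: le_trans (_ : M' * (e / (M' * V + 1)) * V <= _).
  by apply: ler_wpM2r => //; apply: ler_wpM2l => //; exact: ltW.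
have MV : 0 <= M' * V by rewrite mulr_ge0.
have -> : M' * (e / (M' * V + 1)) * V = e * (M' * V / (M' * V + 1)).
  by field; rewrite gt_eqF// ltr_wpDl.
by rewrite ler_piMr ?(ltW e0)// ler_pdivrMr ?ltr_wpDl// mul1r lerDl.
Qed.

End Shift.

(** * Weights and paraproducts *)

Section Weights.
Context {R : realType}.
Local Notation mu := (@lebesgue_measure R).
Implicit Types (I J K L : dyadic) (f g u v w b d : R -> R) (x : R).

(** [A2_char] averages over closed intervals; the extra endpoint is a null set. *)
Lemma integral_dset I g : measurable_fun setT g ->
  (\int[mu]_(x in dset I) (g x)%:E =
   \int[mu]_(x in `[(I.2%:~R * dlen I)%R, ((I.2 +
     1)%:~R * dlen I)%R]) (g x)%:E)%E.
Proof.
move=> mg; apply: integral_itv_bndo_bndc; apply/measurable_EFinP.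
exact: measurable_funS mg.
Qed.

Lemma dset_endpoints I : (I.2 + 1)%:~R * dlen I - I.2%:~R * dlen I =
  dlen I :> R.
Proof. by rewrite intrD; ring. Qed.

Lemma loc1_ge0 g : measurable_fun setT g -> (forall x, 0 <= g x) ->
    (forall I, (\int[mu]_(x in dset I) (g x)%:E < +oo)%E) -> loc1 g.
Proof.
move=> mg g0 gI; split => // I; apply/integrableP; split.
  by apply/measurable_EFinP; exact: measurable_funS mg.
apply: le_lt_trans (gI I); rewrite le_eqVlt; apply/orP; left; apply/eqP.
by apply: eq_integral => x _; rewrite gee0_abs ?lee_fin.
Qed.

Lemma measurable_inv w : (forall x, 0 < w x) -> measurable_fun setT w ->
  measurable_fun setT (fun x => (w x)^-1).
Proof.
move=> w0 mw; have -> : (fun x => (w x)^-1) = (fun x => w x `^ -1).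
  by apply/funext => x; rewrite powR_inv1// ltW.
exact: measurableT_comp (measurable_powR (-1)) mw.
Qed.

(** Local integrability of 1/w comes from the A_2 condition: an infinite integral over I, multiplied
    by the positive average of w, would make the characteristic infinite. *)
Lemma A2_loc1 w : A2_weight w -> [/\ loc1 w, loc1 (fun x => (w x)^-1),
  A2_char w = (fine (A2_char w))%:E &
  forall I, ig w I * ig (fun x => (w x)^-1) I <=
    fine (A2_char w) * dlen I ^+ 2].
Proof.
move=> [[w0 [mw _ wint]] A2].
have mv := measurable_inv w0 mw.
have lw : loc1 w.
  apply: loc1_ge0 => // [x|I]; first exact: ltW.
  rewrite integral_dset//.
  have := wint `[I.2%:~R * dlen I, (I.2 +
    1)%:~R * dlen I]%classic (@subsetT _ _)
    (@segment_compact _ _ _); apply: le_lt_trans.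
  rewrite le_eqVlt; apply/orP; left; apply/eqP; apply: eq_integral => x _.
  by rewrite ger0_norm// ltW.
have av I : (avgE w (I.2%:~R * dlen I)%R ((I.2 + 1)%:~R * dlen I)%R *
    avgE (fun x => (w x)^-1)%R (I.2%:~R * dlen I)%R ((I.2 + 1)%:~R * dlen I)%R
    <= A2_char w)%E.
  apply: ereal_sup_ubound; do 2 eexists; split; last reflexivity.
  by rewrite -subr_gt0 dset_endpoints dlen_gt0.
have avw g I : measurable_fun setT g ->
    avgE g (I.2%:~R * dlen I) ((I.2 + 1)%:~R * dlen I) =
    ((dlen I)^-1%:E * \int[mu]_(x in dset I) (g x)%:E)%E.
  by move=> mg; rewrite /avgE dset_endpoints integral_dset.
have fin_A2 : A2_char w \is a fin_num.
  rewrite ge0_fin_numE//; apply: le_trans (av (0, 0)).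
  have i0 (g : R -> R) : (forall x, 0 < g x) -> measurable_fun setT g ->
      (0 <= (dlen (0, 0))^-1%:E * \int[mu]_(x in dset (0%R, 0%R)) (g x)%:E)%E.
    move=> g0 mg; apply: mule_ge0; first by rewrite lee_fin invr_ge0 ltW//
      dlen_gt0.
    by apply: integral_ge0 => x _; rewrite lee_fin ltW.
  by rewrite !avw// mule_ge0// i0// => x; rewrite invr_gt0.
have lv : loc1 (fun x => (w x)^-1).
  apply: loc1_ge0 => // [x|I]; first by rewrite invr_ge0 ltW.
  rewrite ltey; apply/eqP => vy.
  have := av I; rewrite !avw// vy => h.
  have W0 := ig_gt0 I lw w0.
  have e : (\int[mu]_(x in dset I) (w x)%:E = (ig w I)%:E)%E.
    rewrite fineK//; apply: integrable_fin_num; first exact: measurable_dset.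
    by case: lw => _; exact.
  move: h; rewrite e; have l0 : 0 < (dlen I : R)^-1 by rewrite invr_gt0
    dlen_gt0.
  rewrite gt0_muley ?lte_fin// -EFinM gt0_muley ?lte_fin ?mulr_gt0//.
  by rewrite leye_eq => /eqP A2y; move: A2; rewrite A2y ltxx.
split => //; first by rewrite fineK.
move=> I; have := av I; rewrite !avw//.
have e g : loc1 g -> (\int[mu]_(x in dset I) (g x)%:E = (ig g I)%:E)%E.
  move=> [_ lg]; rewrite fineK//; apply: integrable_fin_num => //.
  exact: measurable_dset.
rewrite !e// -(fineK fin_A2) -!EFinM lee_fin.
have l0 := dlen_gt0 I : 0 < dlen I :> R.
have -> : (dlen I)^-1 * ig w I * ((dlen I)^-1 * ig (fun x => (w x)^-1) I) =
  ig w I * ig (fun x => (w x)^-1) I / dlen I ^+ 2 by field; rewrite gt_eqF.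
by rewrite ler_pdivrMr ?exprn_gt0.
Qed.

Lemma loc2_powR w (p : R) : measurable_fun setT w ->
  loc1 (fun x => (w x `^ p) ^+ 2) -> loc2 (fun x => w x `^ p).
Proof.
move=> mw [_ h]; split => //; exact: measurableT_comp (measurable_powR p) mw.
Qed.

Lemma side_integrals d phi : loc2 d -> (forall x, 0 < d x) -> loc2 phi ->
  side (ig d) (ig (fun x => d x ^+ 2)) (ig (fun x => d x * phi x))
    (ig (fun x => `|d x * phi x|)) (ig phi) (ig (fun x => `|phi x|))
    (ig (fun x => phi x ^+ 2)).
Proof.
move=> ld d0 lp; have ldp := loc2M ld lp.
have ln : loc2 (fun x => `|phi x|).
  apply: (@loc2_bounded _ 1 phi) => //.
    by apply: measurableT_comp => //; case: lp.
  by move=> x; rewrite mul1r normr_id.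
have sqn : (fun x => `|phi x| ^+ 2) = (fun x => phi x ^+ 2).
  by apply/funext => x; rewrite real_normK ?num_real.
split.
- exact/ig_dadditive/loc2_loc1.
- exact/ig_dadditive/loc2_sqr.
- exact: ig_dadditive.
- exact/ig_dadditive/loc1_norm.
- exact/ig_dadditive/loc2_loc1.
- exact/ig_dadditive/loc2_loc1.
- exact/ig_dadditive/loc2_sqr.
- by move=> L; apply: ig_gt0 => //; exact: loc2_loc1.
- by move=> L; apply: ig_gt0; [exact: loc2_sqr|move=> x; rewrite exprn_gt0].
- by move=> L; exact: ig_norm.
- by move=> L; apply: ig_norm; exact: loc2_loc1.
- move=> L; have := ig_CS L ln ld; rewrite sqn.
  congr (_ ^+ 2 <= _); apply: eq_ig => x _.
  by rewrite normrM (gtr0_norm (d0 x)) mulrC.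
- move=> L; have := ig_CS L ln (loc2_cst 1); rewrite sqn.
  under [X in _ * ig X L]eq_fun do rewrite expr1n.
  rewrite ig_cst mul1r; congr (_ ^+ 2 <= _).
  by apply: eq_ig => x _; rewrite mulr1.
- move=> L; have := ig_CS L ld (loc2_cst 1).
  under [X in _ * ig X L]eq_fun do rewrite expr1n.
  rewrite ig_cst mul1r; congr (_ ^+ 2 <= _).
  by apply: eq_ig => x _; rewrite mulr1.
Qed.

End Weights.

(** * The three components of the product of d with a Haar polynomial *)

Section Resolution.
Context {R : realType}.
Local Notation mu := (@lebesgue_measure R).
Implicit Types (I J K L : dyadic) (f g u v : R -> R) (x : R).

Lemma ig_sum (s : seq dyadic) (h : dyadic -> R ->
  R) L : (forall I, loc2 (h I)) ->
  ig (fun x => \sum_(I <- s) h I x) L = \sum_(I <- s) ig (h I) L.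
Proof.
move=> lh; elim: s => [|I s IH].
  by rewrite big_nil; apply: ig0 => x _; rewrite big_nil.
under eq_fun do rewrite big_cons.
rewrite big_cons -IH igD//; first exact: loc2_loc1.
exact/loc2_loc1/loc2_sum.
Qed.

Variables (d : R -> R) (F : {fset dyadic}) (c : dyadic -> R).
Hypotheses (ld : loc2 d) (d0 : forall x, 0 < d x).

Let phi : R -> R := haar_sum c F.

Let loc2_phi : loc2 phi.
Proof. by apply: loc2_sum => I; apply: loc2Z; exact: loc2_haar. Qed.

Let loc1_d : loc1 d := loc2_loc1 ld.

(* The components of d phi of types (0,0), (1,0) and (0,1); the last one is an
   infinite sum of Haar functions and is defined as the remainder. *)
Definition component_diag : R -> R :=
  haar_sum (fun I => c I * (ig d I / dlen I)) F.

Definition component_avg : R -> R :=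
  fun x => \sum_(I <- F) (c I * hc (ig d) I) * haar_avg I x.

Definition component_para : R -> R :=
  fun x => d x * phi x + ((-1) * component_diag x + (-1) * component_avg x).

Definition component (t : bool * bool) : R -> R :=
  if t == (false, false) then component_diag
  else if t == (true, false) then component_avg else component_para.

Lemma loc2_d_haar I : loc2 (fun x => d x * haar I x).
Proof.
apply: (@loc2_bounded _ ((Num.sqrt (dlen I))^-1) d) => //.
  by apply: measurable_funM; [case: ld|exact: measurable_haar].
by move=> x; rewrite normrM mulrC ler_wpM2r// haar_bound.
Qed.

Let dphiE : (fun x => d x * phi x) = fun x =>
  \sum_(I <- F) c I * (d x * haar I x).
Proof.
apply/funext => x; rewrite /phi /haar_sum mulr_sumr; apply: eq_bigr => I _.
by rewrite mulrCA.
Qed.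

Lemma loc2_dphi : loc2 (fun x => d x * phi x).
Proof. by rewrite dphiE; apply: loc2_sum => I; apply: loc2Z;
  exact: loc2_d_haar. Qed.

Let loc2_diag : loc2 component_diag.
Proof. by apply: loc2_sum => I; apply: loc2Z; exact: loc2_haar. Qed.

Let loc2_avg : loc2 component_avg.
Proof. by apply: loc2_sum => I; apply: loc2Z; exact: loc2_haar_avg. Qed.

Lemma loc2_component t : loc2 (component t).
Proof.
rewrite /component; case: ifP => // _; case: ifP => // _.
by apply: loc2D; [exact: loc2_dphi|apply: loc2D; exact: loc2Z].
Qed.

Lemma hcD f g L : loc1 f -> loc1 g ->
  hc (ig (fun x => f x + g x)) L = hc (ig f) L + hc (ig g) L.
Proof. by move=> lf lg; rewrite /hc !igD//; ring. Qed.

Lemma hc_lincomb (a : dyadic -> R) (h : dyadic -> R ->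
  R) L : (forall I, loc2 (h I)) ->
  hc (ig (fun x => \sum_(I <- F) a I * h I x)) L =
    \sum_(I <- F) a I * hc (ig (h I)) L.
Proof.
move=> lh; rewrite /hc !ig_sum; try by move=> I; exact: loc2Z.
rewrite -sumrB mulr_sumr; apply: eq_bigr => I _.
by rewrite !igZ; try exact: loc2_loc1; ring.
Qed.

Lemma hc_phi L : hc (ig phi) L = if L \in F then c L else 0.
Proof.
rewrite /phi hc_lincomb; last exact: loc2_haar.
under eq_bigr do rewrite hc_haar.
case: ifPn => LF.
  rewrite (bigD1_seq L)//= ?fset_uniq// eqxx mulr1 big1 ?addr0// => J JL.
  by rewrite (negbTE JL) mulr0.
rewrite big_seq big1// => J JF; case: eqP => [e|]; last by rewrite mulr0.
by move: LF; rewrite -e JF.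
Qed.

Lemma hc_diag L : hc (ig component_diag) L = ig d L / dlen L * hc (ig phi) L.
Proof.
rewrite [LHS]hc_lincomb; last exact: loc2_haar.
rewrite /phi hc_lincomb; last exact: loc2_haar.
rewrite mulr_sumr; apply: eq_bigr => I _; rewrite hc_haar.
by case: eqP => [->|]; rewrite ?mulr1 ?mulr0// mulrC.
Qed.

(** Sum [haar_product] over the terms of phi: its first two terms give the coefficients of
    [component_diag] and [component_avg], so the third is what the remainder keeps. *)
Lemma hc_para L : hc (ig component_para) L = hc (ig d) L * (ig phi L / dlen L).
Proof.
rewrite hcD; last 2 first.
- exact/loc2_loc1/loc2_dphi.
- by apply/loc2_loc1/loc2D; exact: loc2Z.
rewrite hcD; last 2 first.
- exact/loc2_loc1/loc2Z.
- exact/loc2_loc1/loc2Z.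
rewrite !hc_cst; try exact: loc2_loc1.
rewrite hc_diag [X in _ + (_ + _ * X)]hc_lincomb; last exact: loc2_haar_avg.
rewrite dphiE hc_lincomb; last exact: loc2_d_haar.
have -> : ig phi L = \sum_(I <- F) c I * ig (haar I) L.
  rewrite /phi [LHS]ig_sum; last by move=> I; apply: loc2Z; exact: loc2_haar.
  by apply: eq_bigr => I _; rewrite igZ//; exact/loc2_loc1/loc2_haar.
rewrite /phi hc_lincomb; last exact: loc2_haar.
rewrite !mulN1r mulr_sumr mulr_suml mulr_sumr -!sumrN -!big_split /=.
apply: eq_bigr => I _; rewrite haar_product// hc_haar.
by case: eqP => [->|_] /=; ring.
Qed.

(** The coefficient at L of [component_avg] collects contributions of all I strictly inside L;
    writing it as that of d phi minus the other two avoids this sum. *)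
Lemma hc_component_le t L : t \in natural_types ->
  `|hc (ig (component t)) L| <= coefU (ig d) (ig (fun x =>
    d x * phi x)) (ig phi) L.
Proof.
have av0 : 0 <= ig d L / dlen L.
  by rewrite divr_ge0 ?ltW ?dlen_gt0// ig_gt0.
have hD : `|hc (ig component_diag) L| = ig d L / dlen L * `|hc (ig phi) L|.
  by rewrite hc_diag normrM ger0_norm.
have hP : `|hc (ig component_para) L| = `|hc (ig d) L| * (`|ig phi L| / dlen L).
  have l0 := dlen_gt0 L : 0 < dlen L :> R.
  by rewrite hc_para normrM; congr (_ * _);
    rewrite normrM normfV (gtr0_norm l0).
have hA : `|hc (ig component_avg) L| <= `|hc (ig (fun x => d x * phi x)) L| +
    `|hc (ig component_diag) L| + `|hc (ig component_para) L|.
  have e : hc (ig component_avg) L = hc (ig (fun x => d x * phi x)) L -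
      hc (ig component_diag) L - hc (ig component_para) L.
    rewrite [hc (ig component_para) L]hcD; last 2 first.
    - exact/loc2_loc1/loc2_dphi.
    - by apply/loc2_loc1/loc2D; exact: loc2Z.
    rewrite hcD; last 2 first.
    - exact/loc2_loc1/loc2Z.
    - exact/loc2_loc1/loc2Z.
    by rewrite !hc_cst; try exact: loc2_loc1; ring.
  rewrite e; apply: le_trans (ler_normB _ _) _.
  by rewrite lerD2r; exact: ler_normB.
rewrite /coefU -hD -hP.
have := normr_ge0 (hc (ig (fun x => d x * phi x)) L).
have := normr_ge0 (hc (ig component_diag) L); have :=
  normr_ge0 (hc (ig component_para) L).
rewrite !inE /component => n1 n2 n3 /or3P[] /eqP-> /=; move: hA n1 n2 n3; lra.
Qed.

Lemma component_supported m t : (forall I x, I \in F -> dset I x ->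
  - 2 ^ m <= x < 2 ^ m) ->
  supported m phi /\ supported m (component t).
Proof.
move=> Fm.
have out x I : ~ (- 2 ^ m <= x < 2 ^ m) -> I \in F -> ~ dset I x.
  by move=> nx IF /(Fm _ _ IF).
have hs (a : dyadic -> R) : supported m (haar_sum a F).
  move=> x nx; rewrite /haar_sum big_seq big1// => I IF.
  by rewrite haar_out ?mulr0//; exact: (out _ _ nx IF).
split; first exact: hs.
have ha : supported m component_avg.
  move=> x nx; rewrite /component_avg big_seq big1// => I IF.
  by rewrite haar_avg_out ?mulr0//; exact: (out _ _ nx IF).
rewrite /component; case: ifP => _; first exact: hs.
case: ifP => _ //; move=> x nx.
have p0 : phi x = 0 := hs _ x nx; have q0 : component_diag x = 0 := hs _ x nx.
by rewrite /component_para p0 q0 ha// !mulr0 !addr0.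
Qed.

Lemma sqr_integrable_phi : sqr_integrable setT phi.
Proof. exact: sqr_integrable_haar_sum. Qed.

(** For types (0,0) and (0,1) the series is the Haar expansion of the component. For type (1,0) its
    terms vanish off F, so the error is exactly 0 once F is included. *)
Lemma paraproduct_component m t : supported m (component t) ->
  t \in natural_types ->
  is_paraproduct (symbol d t) t phi (component t).
Proof.
move=> sup tn; rewrite /is_paraproduct.
have exp := haar_expansion (loc2_component t) sup.
have L2phi := sqr_integrable_phi.
have dotphi I : L2dot phi (haar I) = hc (ig phi) I by rewrite /L2dot dot_haar.
have cases : [\/ t = (false, true), t = (true, false) | t = (false, false)].
  by move: tn; rewrite !inE => /or3P[] /eqP->;
    [constructor 1|constructor 2|constructor 3].
case: cases sup exp => -> sup exp.
- rewrite (_ : (fun I x => _) = fun I x =>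
  hc (ig component_para) I * haar I x)//.
  apply/funext => I; apply/funext => x; rewrite /symbol /= haar_coefE//.
  by rewrite L2dot_haar_avg ?hc_para//; exact: loc2_loc1.
- split; first by apply/L2P; case: (supported_sqr loc2_avg sup).
  move=> e e0; exists F => F' FF'.
  rewrite (_ : (fun x => _) = fun x => 0 * haar (0, 0) x).
    rewrite L2normE; last exact/sqr_integrableZ/sqr_integrable_haar.
    rewrite (_ : \int[mu]_x _ = 0) ?sqrtr0 ?lte_fin//.
    rewrite (@eq_Rintegral _ _ _ _ _ (fun=> 0));
      first by rewrite Rintegral_cst// mul0r.
    by move=> x _; rewrite mul0r expr0n.
  apply/funext => x; rewrite mul0r; apply/eqP; rewrite subr_eq0; apply/eqP.
  transitivity (\sum_(I <- F) symbol d (true, false) I * L2dot phi (haar I) *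
      haar_avg I x).
    rewrite /component /component_avg /= big_seq [RHS]big_seq;
      apply: eq_bigr => I IF.
    by rewrite dotphi hc_phi IF /symbol /= haar_coefE// [c I * _]mulrC.
  apply: big_fset_incl FF' _ => I _ IF.
  by rewrite dotphi hc_phi (negbTE IF) mulr0 mul0r.
- rewrite (_ : (fun I x => _) = fun I x =>
  hc (ig component_diag) I * haar I x)//.
  apply/funext => I; apply/funext => x; rewrite /symbol /= dotphi hc_diag.
  by rewrite /dyadic_avg -/(ig d I) [_^-1 * _]mulrC.
Qed.

End Resolution.

(** * The bound for the form on Haar polynomials *)

Section FormBound.
Context {R : realType}.
Local Notation mu := (@lebesgue_measure R).
Implicit Types (I J K L : dyadic) (x : R).

Variables (d b : R -> R) (F G : {fset dyadic}) (c c' : dyadic -> R) (Q : R).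
Hypotheses (ld : loc2 d) (lb : loc2 b).
Hypotheses (d0 : forall x, 0 < d x) (b0 : forall x, 0 < b x).
Hypothesis bd1 : forall x, d x * b x = 1.
Hypothesis A2 : forall I,
  ig (fun x => b x ^+ 2) I * ig (fun x => d x ^+ 2) I <= Q * dlen I ^+ 2.

Let phi : R -> R := haar_sum c F.
Let psi : R -> R := haar_sum c' G.
Let U := coefU (ig d) (ig (fun x => d x * phi x)) (ig phi).
Let V := coefU (ig b) (ig (fun x => b x * psi x)) (ig psi).

Let loc2_haar_sum a (s : seq dyadic) : loc2 (haar_sum a s : R -> R).
Proof. by apply: loc2_sum => I; apply: loc2Z; exact: loc2_haar. Qed.

Let tree_le n J : \sum_(K <- tree n J) (fam U K * fam V K) <=
  48 ^+ 2 * side_const * Q * Num.sqrt (ig (fun x => phi x ^+ 2) J) *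
  Num.sqrt (ig (fun x => psi x ^+ 2) J).
Proof.
have lphi : loc2 phi by exact: loc2_haar_sum.
have lpsi : loc2 psi by exact: loc2_haar_sum.
have sd := side_integrals ld d0 lphi.
have sb := side_integrals lb b0 lpsi.
apply: (@bilinear_tree _ [:: ig d; ig (fun x => `|d x * phi x|);
  ig (fun x => `|phi x|);
   ig b; ig (fun x => `|b x * psi x|); ig (fun x => `|psi x|)] erefl _ _
   _ _ _ _ _ _ _ _ _ _ _ _ _ _ Q n J sd sb (perm_refl _)) => //.
- move=> q; rewrite !inE => /or4P[|||/or3P[]] /eqP-> L; apply: ig_ge0 => x //;
    exact: ltW.
- move=> q; rewrite !inE => /or4P[|||/or3P[]] /eqP->.
  + exact: side_D sd.
  + exact: side_Af sd.
  + exact: side_P1 sd.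
  + exact: side_D sb.
  + exact: side_Af sb.
  + exact: side_P1 sb.
- by move=> K; apply: dlen_sqr_le => //; exact: loc2_loc1.
Qed.

(** The coefficients at I and at its children are all dominated by [fam] at I, so the sum is at most
    that over the two trees containing H. Each tree is bounded by the global norms, whence the
    factor 2. *)
Lemma form_le t1 t2 (H : {fset dyadic}) :
    t1 \in natural_types -> t2 \in natural_types ->
  \sum_(I <- H) `|hc (ig (component d F c t2)) I| *
    (`|hc (ig (component b G c' t1)) (dleft I)| +
      `|hc (ig (component b G c' t1)) (dright I)|) <=
  2 * (48 ^+ 2 * side_const) * Q * Num.sqrt (\int[mu]_x (phi x ^+ 2)) *
    Num.sqrt (\int[mu]_x (psi x ^+ 2)).
Proof.
move=> h1 h2.
have U0 I : 0 <= U I := le_trans (normr_ge0 _) (hc_component_le F c ld d0 I h2).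
have V0 I : 0 <= V I := le_trans (normr_ge0 _) (hc_component_le G c' lb b0 I
  h1).
have famU0 I : 0 <= fam U I := fam_ge0 I U0.
have famV0 I : 0 <= fam V I := fam_ge0 I V0.
apply: le_trans (_ : \sum_(I <- H) (fam U I * fam V I) <= _).
  apply: ler_sum => I _; apply: ler_pM; [by []|by rewrite addr_ge0| |].
    apply: le_trans (hc_component_le F c ld d0 I h2) _.
    by rewrite /fam -addrA lerDl addr_ge0.
  apply: le_trans (lerD (hc_component_le G c' lb b0 _ h1) (hc_component_le G c'
    lb b0 _ h1)) _.
  by rewrite [leRHS]/fam -[leRHS]addrA lerDr; exact: V0.
have [m [N hN]] := seq_in_tree (F ++ G ++ H).
have {}hN := hN 0%N N ltac:(by rewrite addn0); rewrite addr0 in hN.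
have dsetm I x : I \in F ++ G ++ H -> dset I x -> - 2 ^ m <= x < 2 ^ m.
  by move=> /hN; exact: tops_bounded.
have [sphi _] : supported m phi /\ supported m (component d F c t2).
  by apply: component_supported => I x IF; apply: dsetm; rewrite mem_cat IF.
have [spsi _] : supported m psi /\ supported m (component b G c' t1).
  by apply: component_supported => I x IG; apply: dsetm;
    rewrite !mem_cat IG orbT.
have [_ ephi] := supported_sqr (loc2_haar_sum c F) sphi.
have [_ epsi] := supported_sqr (loc2_haar_sum c' G) spsi.
have p2 (f : R -> R) J : 0 <= ig (fun x => f x ^+ 2) J.
  by apply: ig_ge0 => x; exact: sqr_ge0.
have Q0 : 0 <= Q.
  have l0 : 0 < dlen (0, 0) ^+ 2 :> R by rewrite exprn_gt0// dlen_gt0.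
  by rewrite -(pmulr_lge0 _ l0) (le_trans _ (A2 _))// mulr_ge0.
have C0 : 0 <= 48 ^+ 2 * side_const * Q :> R.
  by rewrite mulr_ge0// ltW// mulr_gt0 ?side_const_gt0 ?exprn_gt0.
have top J : J = (m, 0) \/ J = (m, -1) ->
    \sum_(K <- tree N J) (fam U K * fam V K) <= 48 ^+ 2 * side_const * Q *
    Num.sqrt (\int[mu]_x (phi x ^+ 2)) * Num.sqrt (\int[mu]_x (psi x ^+ 2)).
  move=> Jm; apply: le_trans (tree_le N J) _; apply: ler_pM.
  - by rewrite mulr_ge0// sqrtr_ge0.
  - exact: sqrtr_ge0.
  - rewrite ler_wpM2l// ler_wsqrtr// ephi.
    by case: Jm => ->; rewrite ?lerDl ?lerDr.
  - rewrite ler_wsqrtr// epsi.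
    by case: Jm => ->; rewrite ?lerDl ?lerDr.
apply: le_trans (_ : \sum_(I <- tree N (m, 0) ++ tree N (m,
  -1)) (fam U I * fam V I) <= _).
  apply: sum_subset_le; first exact: fset_uniq.
    by move=> I IH; apply: hN; rewrite !mem_cat IH !orbT.
  by move=> I; rewrite mulr_ge0.
rewrite big_cat /=; apply: le_trans (lerD (top _ (or_introl erefl)) (top _
  (or_intror erefl))) _.
set B : R := 48 ^+ 2 * side_const; set X := Num.sqrt _; set Y := Num.sqrt _.
have -> : 2 * B * Q * X * Y = B * Q * X * Y + B * Q * X * Y by ring.
exact: lexx.
Qed.

End FormBound.

Theorem theorem1p2 (R : realType) :
  exists C : R, 0 < C /\
    forall S : (R -> R) -> (R -> R), is_haar_shift S ->
    forall w : R -> R, A2_weight w ->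
    forall t1 t2 : bool * bool, t1 \in natural_types -> t2 \in natural_types ->
      Q_norm_le S w t1 t2 (C%:E * A2_char w)%E.
Proof.
exists (2 * (48 ^+ 2 * side_const)); split.
  by rewrite mulr_gt0// mulr_gt0 ?side_const_gt0 ?exprn_gt0.
move=> S hS w Aw t1 t2 h1 h2 _ _ [F [c ->]] [G [c' ->]].
have [lw lv AE A2] := A2_loc1 Aw; set Q := fine (A2_char w) in A2.
have w0 := Aw.1.1; have mw : measurable_fun setT w by case: lw.
pose b x := w x `^ 2^-1; pose d x := w x `^ (- 2^-1).
have b0 x : 0 < b x by rewrite powR_gt0.
have d0 x : 0 < d x by rewrite powR_gt0.
have bE : (fun x => b x ^+ 2) = w.
  by apply/funext => x; rewrite /b powR12_sqrt ?sqr_sqrtr// ltW.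
have dE : (fun x => d x ^+ 2) = fun x => (w x)^-1.
  by apply/funext => x; rewrite /d powRN exprVn; congr (_^-1);
    rewrite -[in RHS]bE.
have db x : d x * b x = 1 by rewrite /d powRN mulVf// gt_eqF// b0.
have lb : loc2 b by apply: loc2_powR => //; move: lw; rewrite -[X in loc1 X]bE.
have ld : loc2 d by apply: loc2_powR => //; move: lv; rewrite -[X in loc1 X]dE.
have A2' I : ig (fun x => b x ^+ 2) I * ig (fun x => d x ^+ 2) I <=
  Q * dlen I ^+ 2.
  by rewrite bE dE.
(* v belongs to the formal adjoint, of swapped type. The natural types are stable under the swap,
   and the symbol only depends on whether the type is (0,0). *)
have h1' : (t1.2, t1.1) \in natural_types by case: t1 h1 => [[] []].
have sym : symbol b t1 = symbol b (t1.2, t1.1) by case: t1 {h1 h1'} => [[] []].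
have [m [N hN]] := seq_in_tree (F ++ G).
have {}hN := hN 0%N N ltac:(by rewrite addn0); rewrite addr0 in hN.
have dsetm I x : I \in F ++ G -> dset I x -> - 2 ^ m <= x < 2 ^ m.
  by move=> /hN; exact: tops_bounded.
have [_ su] : supported m (haar_sum c F : R ->
  R) /\ supported m (component d F c t2).
  apply: component_supported => I x IF; apply: dsetm; by rewrite mem_cat IF.
have [_ sv] : supported m (haar_sum c' G : R ->
  R) /\ supported m (component b G c' (t1.2, t1.1)).
  apply: component_supported => I x IG; apply: dsetm;
    by rewrite mem_cat IG orbT.
exists (component d F c t2), (component b G c' (t1.2, t1.1)); split.
- exact: paraproduct_component su h2.
- rewrite sym; exact: paraproduct_component sv h1'.
rewrite AE -/Q !L2normE; try exact: sqr_integrable_haar_sum.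
rewrite -!EFinM lee_fin.
apply: (shift_form_le hS (loc2_component F c ld t2) su).
  by case: (supported_sqr (loc2_component G c' lb (t1.2, t1.1)) sv).
by move=> H; exact: form_le.
Qed.
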